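(* For $n\ge1$ let $$\mathcal{X}_{\sigma,n}=\mathbb{A}^0\sqcup\bigsqcup_{m=0}^{n-1}\mathbb{A}^{m+1}\times(\mathbb{A}^1\smallsetminus\{0\})\times(\mathbb{A}^2\smallsetminus\{0\})\times\cdots\times(\mathbb{A}^m\smallsetminus\{0\}),$$ with counting function $N_{\mathcal{X}_{\sigma,n}}(q)=1+\sum_{m=0}^{n-1}q^{m+1}(q-1)(q^2-1)\cdots(q^m-1)$, and let $\mathcal{X}_\sigma=\varinjlim_n\mathcal{X}_{\sigma,n}$. Then $N_{\mathcal{X}_{\sigma,n}}(1-n)\ge0$ for $n=1$, for $n=4k+3$ with $k\ge0$, and for $n=4k$ with $k\ge1$. Thus $\mathcal{X}_\sigma$ has an $\mathbb{F}_\zeta$-structure at nontrivial roots of unity $\zeta$ of order $4k+3$ and $4k$.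
   Context: All varieties are over $\mathbb{Z}$. For a variety $X$, $N_X(q)=\#X(\mathbb{F}_q)$ for prime powers $q$; when this is given by a polynomial in $q$, the polynomial is also denoted $N_X$ and may be evaluated at any integer. $K_0(\mathcal{V}_{\mathbb{Z}})$ is the Grothendieck ring of varieties over $\mathbb{Z}$, generated by isomorphism classes $[X]$ with $[X]=[Y]+[X\smallsetminus Y]$ for closed $Y\subset X$ and $[X\times Y]=[X][Y]$; $\mathbb{L}=[\mathbb{A}^1]$, $\mathbb{T}=\mathbb{L}-1=[\mathbb{G}_m]$. A geometric torification of a variety $X$ is a morphism $e:T\to X$ with $T=\coprod_{j}T_j$, $T_j=\mathbb{G}_m^{k_j}$, such that each $e|_{T_j}$ is an immersion and $e$ induces a bijection $T(k)\simeq X(k)$ for every field $k$. An ind-variety $\mathcal{X}=\varinjlim_N\mathcal{X}_N$ over $\mathbb{Z}$ has an $\mathbb{F}_1$-structure if: (i) the $\mathcal{X}_N$ have a decomposition of the form $$\mathcal{X}_N=\bigsqcup_{m=0}^{N-1}X_m\times(\mathbb{A}^m\smallsetminus\{0\})\times\cdots\times(\mathbb{A}^2\smallsetminus\{0\})\times(\mathbb{A}^1\smallsetminus\{0\})$$ (meaning that both sides can be partitioned into finitely many locally closed subvarieties that are pairwise isomorphic), where the varieties $X_m$ admit a geometric torification by tori $\mathbb{G}_m^{k_j}$; (ii) the classes $[\mathcal{X}_N]$ define an element $\sum_{m\ge0}\alpha_m(\mathbb{L})(\mathbb{L}^m-1)\cdots(\mathbb{L}-1)$ of $\varprojlim_n\mathbb{Z}[\mathbb{L}]/((\mathbb{L}-1)\cdots(\mathbb{L}^n-1))$,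 where $[X_m]=\alpha_m(\mathbb{L})=\sum_j\mathbb{T}^{k_j}$; (iii) the counting functions $N_{\mathcal{X}_N}(q)$ determine the element $\sum_{m\ge0}\alpha_m(q)(q^m-1)\cdots(q-1)$ of the Habiro ring $\varprojlim_n\mathbb{Z}[q]/((1-q)\cdots(1-q^n))$, where $\alpha_m(q)=N_{X_m}(q)=\sum_j(q-1)^{k_j}$. For $\zeta$ a root of unity of order $n$, $\mathcal{X}$ has an $\mathbb{F}_\zeta$-structure if it has an $\mathbb{F}_1$-structure and the polynomial $N_{\mathcal{X}_n}(q)=\sum_{m=0}^{n-1}\alpha_m(q)(q^m-1)\cdots(q-1)$ satisfies $N_{\mathcal{X}_n}(1-n)\ge0$. *)

(* Defs.v *)
From HB Require Import structures.
From mathcomp Require Import all_boot all_order all_algebra all_field.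
From mathcomp Require Import boolp.
From mathcomp Require Import mpoly.

Set Implicit Arguments.
Unset Strict Implicit.
Unset Printing Implicit Defensive.

Import Order.TTheory GRing.Theory Num.Theory.
Local Open Scope ring_scope.

(* Schemes are Z-functors, i.e. functors of points on commutative rings (the  *)
(* zero ring included), in the sense of Demazure and Gabriel.                 *)

Record zfunctor := ZFunctor {
  pts :> comPzRingType -> Type;
  act : forall R S : comPzRingType, {rmorphism R -> S} -> pts R -> pts S;
  actI : forall (R : comPzRingType) (f : {rmorphism R -> R}) (x : pts R),
    f =1 id -> act f x = x;
  actM : forall (R S T : comPzRingType) (f : {rmorphism R -> S})
    (g : {rmorphism S -> T}) (h : {rmorphism R -> T}) (x : pts R),
    h =1 g \o f -> act h x = act g (act f x) }.

Record zmor (X Y : zfunctor) := ZMor {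
  mor :> forall R : comPzRingType, X R -> Y R;
  mor_nat : forall (R S : comPzRingType) (f : {rmorphism R -> S}) (x : X R),
    mor (act f x) = act f (mor x) }.

Definition isomorphic (X Y : zfunctor) :=
  exists (f : zmor X Y) (g : zmor Y X),
    forall R : comPzRingType, cancel (f R) (g R) /\ cancel (g R) (f R).

Definition zpred (X : zfunctor) := forall R : comPzRingType, X R -> Prop.

Definition zfull (X : zfunctor) : zpred X := fun _ _ => True.

Definition image_of (X Y : zfunctor) (f : zmor X Y) : zpred Y :=
  fun R y => exists x : X R, f R x = y.

Definition zinjective (X Y : zfunctor) (f : zmor X Y) :=
  forall R : comPzRingType, injective (f R).

Definition generates_unit_ideal (R : comPzRingType) (J : R -> Prop) :=
  exists (n : nat) (a b : 'I_n -> R),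
    (forall i, J (a i)) /\ \sum_(i < n) b i * a i = 1.

(* Pulled back along any point x of X(R), i.e. along x : Spec R -> X, the     *)
(* subfunctor U becomes the open subfunctor D(I) of Spec R, whose S-points    *)
(* are the f : R -> S with f(I)S = S.                                         *)
Definition open_sub (X : zfunctor) (U : zpred X) :=
  forall (R : comPzRingType) (x : X R), exists I : R -> Prop,
    forall (S : comPzRingType) (f : {rmorphism R -> S}),
      U S (act f x) <->
      generates_unit_ideal (fun s => exists2 r, I r & s = f r).

(* Pulled back along any point of U, the subfunctor Z becomes a closed        *)
(* subfunctor V(I) of Spec R, whose S-points are the f : R -> S with f(I) = 0.*)
Definition closed_sub_in (X : zfunctor) (U Z : zpred X) :=
  forall (R : comPzRingType) (x : X R), U R x -> exists I : R -> Prop,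
    forall (S : comPzRingType) (f : {rmorphism R -> S}),
      Z S (act f x) <-> (forall r, I r -> f r = 0).

Definition open_immersion (X Y : zfunctor) (f : zmor X Y) :=
  zinjective f /\ open_sub (image_of f).

Definition closed_immersion (X Y : zfunctor) (f : zmor X Y) :=
  zinjective f /\ closed_sub_in (@zfull Y) (image_of f).

Definition immersion (X Y : zfunctor) (f : zmor X Y) :=
  zinjective f /\ exists U : zpred Y,
    [/\ open_sub U, forall R (y : Y R), image_of f y -> U R y
      & closed_sub_in U (image_of f)].

Lemma rmorphism_ext (R S : pzSemiRingType) (f g : {rmorphism R -> S}) :
  f =1 g -> f = g.
Proof.
case: f g => f cf [g cg] /= /funext fg; case: _ / fg in cg *.
case: cf cg => [[fD] [fM]] [[gD] [gM]].
by rewrite (Prop_irrelevance fD gD) (Prop_irrelevance fM gM).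
Qed.

Lemma zspec_actI (A R : comPzRingType) (f : {rmorphism R -> R})
    (x : {rmorphism A -> R}) :
  f =1 id -> (f \o x : {rmorphism A -> R}) = x.
Proof. by move=> fid; apply: rmorphism_ext => a /=; rewrite fid. Qed.

Lemma zspec_actM (A R S T : comPzRingType) (f : {rmorphism R -> S})
    (g : {rmorphism S -> T}) (h : {rmorphism R -> T}) (x : {rmorphism A -> R}) :
  h =1 g \o f ->
  (h \o x : {rmorphism A -> T}) = (g \o (f \o x) : {rmorphism A -> T}).
Proof. by move=> hgf; apply: rmorphism_ext => a /=; rewrite hgf. Qed.

Definition zspec (A : comPzRingType) : zfunctor :=
  @ZFunctor (fun R => {rmorphism A -> R})
    (fun R S f x => f \o x : {rmorphism A -> S})
    (@zspec_actI A) (@zspec_actM A).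

(* f : R -> S exhibits S as the localization R[1/a]. *)
Definition is_localization (R S : comPzRingType) (f : {rmorphism R -> S})
    (a : R) :=
  [/\ exists u, f a * u = 1,
      forall s, exists (n : nat) (r : R), f a ^+ n * s = f r
    & forall r, f r = 0 -> exists n : nat, a ^+ n * r = 0].

Definition zariski_sheaf (X : zfunctor) :=
  forall (R : comPzRingType) (n : nat) (a : 'I_n -> R)
    (S : 'I_n -> comPzRingType) (loc : forall i, {rmorphism R -> S i})
    (T : 'I_n -> 'I_n -> comPzRingType)
    (l : forall i j, {rmorphism S i -> T i j})
    (r : forall i j, {rmorphism S j -> T i j}),
  (exists b : 'I_n -> R, \sum_(i < n) b i * a i = 1) ->
  (forall i, is_localization (loc i) (a i)) ->
  (forall i j, l i j \o loc i =1 r i j \o loc j) ->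
  (forall i j,
    is_localization (l i j \o loc i : {rmorphism R -> T i j}) (a i * a j)) ->
  forall x : forall i, X (S i),
  (forall i j, act (l i j) (x i) = act (r i j) (x j)) ->
  exists! y : X R, forall i, act (loc i) y = x i.

Definition finitely_generated (A : comPzRingType) :=
  exists (n : nat) (f : {rmorphism {mpoly int[n]} -> A}),
    forall a, exists p, f p = a.

Definition finite_affine_cover (X : zfunctor) :=
  exists (n : nat) (A : 'I_n -> comPzRingType)
    (f : forall i, zmor (zspec (A i)) X),
    (forall i, finitely_generated (A i) /\ open_immersion (f i)) /\
    (forall (K : fieldType) (x : X K), exists i, image_of (f i) x).

Definition separated (X : zfunctor) :=
  forall (R : comPzRingType) (x y : X R), exists I : R -> Prop,
    forall (S : comPzRingType) (f : {rmorphism R -> S}),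
      act f x = act f y <-> (forall r, I r -> f r = 0).

(* Varieties over Z are the separated schemes of finite type over Z. They are *)
(* not required to be reduced: over Z this would not be stable under products.*)
Definition is_variety (X : zfunctor) :=
  [/\ zariski_sheaf X, finite_affine_cover X & separated X].

Lemma affine_actM n (R S T : comPzRingType) (f : {rmorphism R -> S})
    (g : {rmorphism S -> T}) (h : {rmorphism R -> T}) (x : 'rV[R]_n) :
  h =1 g \o f -> map_mx h x = map_mx g (map_mx f x).
Proof. by move=> hgf; apply/rowP => i; rewrite !mxE hgf. Qed.

Definition affine (n : nat) : zfunctor :=
  @ZFunctor (fun R => 'rV[R]_n) (fun R S f x => map_mx f x)
    (fun R f x fid => map_mx_id fid x) (@affine_actM n).

Lemma sval_inj (T : Type) (P : T -> Prop) (u v : {x | P x}) :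
  sval u = sval v -> u = v.
Proof. by case: u v => [u up] [v vp] /= uv; apply: eq_exist. Qed.

Section Gm.

Definition unit_pts (R : comPzRingType) := {u : R | exists v, u * v = 1}.

Lemma unit_act_subproof (R S : comPzRingType) (f : {rmorphism R -> S})
    (u : unit_pts R) : exists v, f (sval u) * v = 1.
Proof. by case: u => u [v uv] /=; exists (f v); rewrite -rmorphM uv rmorph1. Qed.

Definition unit_act (R S : comPzRingType) (f : {rmorphism R -> S}) u : unit_pts S := exist _ _ (@unit_act_subproof R S f u).

Lemma unit_actI (R : comPzRingType) (f : {rmorphism R -> R}) u : f =1 id -> unit_act f u = u.
Proof. by move=> fid; apply: sval_inj => /=; rewrite fid. Qed.

Lemma unit_actM (R S T : comPzRingType) (f : {rmorphism R -> S}) (g : {rmorphism S -> T})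
    (h : {rmorphism R -> T}) u :
  h =1 g \o f -> unit_act h u = unit_act g (unit_act f u).
Proof. by move=> hgf; apply: sval_inj => /=; rewrite hgf. Qed.

Definition Gm : zfunctor := ZFunctor unit_actI unit_actM.

End Gm.

Section Product.
Variables X Y : zfunctor.

Definition zprod_act (R S : comPzRingType) (f : {rmorphism R -> S})
  (p : X R * Y R) : X S * Y S := (act f p.1, act f p.2).

Lemma zprod_actI (R : comPzRingType) (f : {rmorphism R -> R}) p : f =1 id -> zprod_act f p = p.
Proof. by move=> fid; case: p => x y; rewrite /zprod_act !actI. Qed.

Lemma zprod_actM (R S T : comPzRingType) (f : {rmorphism R -> S}) (g : {rmorphism S -> T})
    (h : {rmorphism R -> T}) p :
  h =1 g \o f -> zprod_act h p = zprod_act g (zprod_act f p).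
Proof. by move=> hgf; rewrite /zprod_act !(actM _ hgf). Qed.

Definition zprod : zfunctor := ZFunctor zprod_actI zprod_actM.

End Product.

Section FamilyProduct.
Variables (n : nat) (X : 'I_n -> zfunctor).

Definition zprodn_act (R S : comPzRingType) (f : {rmorphism R -> S})
  (x : forall i, X i R) : forall i, X i S := fun i => act f (x i).

Lemma zprodn_actI (R : comPzRingType) (f : {rmorphism R -> R}) x : f =1 id -> zprodn_act f x = x.
Proof. by move=> fid; apply: functional_extensionality_dep => i; apply: actI. Qed.

Lemma zprodn_actM (R S T : comPzRingType) (f : {rmorphism R -> S}) (g : {rmorphism S -> T})
    (h : {rmorphism R -> T}) x :
  h =1 g \o f -> zprodn_act h x = zprodn_act g (zprodn_act f x).
Proof. by move=> hgf; apply: functional_extensionality_dep => i; apply: actM. Qed.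

Definition zprodn : zfunctor := ZFunctor zprodn_actI zprodn_actM.

End FamilyProduct.

Definition torus (k : nat) : zfunctor := @zprodn k (fun=> Gm).

(* The open complement of a closed subfunctor Z: the points that lie in Z     *)
(* after no base change to a nonzero ring.                                    *)
Section Complement.
Variables (X : zfunctor) (Z : zpred X).

Definition compl_pts (R : comPzRingType) :=
  {x : X R | forall (S : comNzRingType) (f : {rmorphism R -> S}), ~ Z (act f x)}.

Lemma compl_act_subproof (R S : comPzRingType) (f : {rmorphism R -> S})
    (x : compl_pts R) :
  forall (T : comNzRingType) (g : {rmorphism S -> T}),
    ~ Z (act g (act f (sval x))).
Proof. by case: x => x xZ T g /=; rewrite -(@actM _ _ _ _ f g (g \o f)). Qed.

Definition compl_act (R S : comPzRingType) (f : {rmorphism R -> S}) x : compl_pts S :=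
  exist _ _ (@compl_act_subproof R S f x).

Lemma compl_actI (R : comPzRingType) (f : {rmorphism R -> R}) x : f =1 id -> compl_act f x = x.
Proof. by move=> fid; apply: sval_inj => /=; rewrite actI. Qed.

Lemma compl_actM (R S T : comPzRingType) (f : {rmorphism R -> S}) (g : {rmorphism S -> T})
    (h : {rmorphism R -> T}) x :
  h =1 g \o f -> compl_act h x = compl_act g (compl_act f x).
Proof. by move=> hgf; apply: sval_inj => /=; apply: actM. Qed.

Definition complement : zfunctor := ZFunctor compl_actI compl_actM.

End Complement.

Definition punctured_affine (n : nat) : zfunctor :=
  @complement (affine n) (fun R (v : 'rV[R]_n) => v = 0).

(* The ring e R for an idempotent e of R, with unit element e; it is the      *)
(* localization R[1/e] and the quotient R / (1 - e).                          *)
Section Corner.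
Variable R : comPzRingType.

Record idem := Idem { ival : R; idemP : ival * ival = ival }.

Definition idem_compl_subproof (e : idem) : (1 - ival e) * (1 - ival e) = 1 - ival e.
Proof. by rewrite mulrBl mul1r mulrBr mulr1 idemP subrr subr0. Qed.

Definition idem_compl (e : idem) := Idem (idem_compl_subproof e).

Variable e : idem.

Definition in_corner : pred R := fun x => x * ival e == x.

Record corner := Corner { corner_val : R; _ : in_corner corner_val }.

HB.instance Definition _ := [isSub for corner_val].
HB.instance Definition _ := [Choice of corner by <:].

Lemma in_corner_zmod_closed : zmod_closed in_corner.
Proof.
split=> [|x y]; rewrite !unfold_in /in_corner ?mul0r //.
by move=> /eqP xe /eqP ye; rewrite mulrBl xe ye.
Qed.
HB.instance Definition _ :=
  GRing.isZmodClosed.Build R in_corner in_corner_zmod_closed.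
HB.instance Definition _ := [SubChoice_isSubZmodule of corner by <:].

Lemma cornerE (x : corner) : val x * ival e = val x.
Proof. by case: x => x xe /=; apply/eqP. Qed.

Definition corner_one : corner := @Corner (ival e) (introT eqP (idemP e)).

Lemma corner_mul_subproof (x y : corner) : in_corner (val x * val y).
Proof. by rewrite /in_corner -mulrA cornerE. Qed.

Definition corner_mul x y : corner := Corner (corner_mul_subproof x y).

Lemma corner_mulA : associative corner_mul.
Proof. by move=> x y z; apply: val_inj; rewrite /= mulrA. Qed.
Lemma corner_mulC : commutative corner_mul.
Proof. by move=> x y; apply: val_inj; rewrite /= mulrC. Qed.
Lemma corner_mul1 : left_id corner_one corner_mul.
Proof. by move=> x; apply: val_inj; rewrite /= mulrC cornerE. Qed.
Lemma corner_mulD : left_distributive corner_mul +%R.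
Proof. by move=> x y z; apply: val_inj; rewrite /= mulrDl. Qed.

HB.instance Definition _ := GRing.Zmodule_isComPzRing.Build corner
  corner_mulA corner_mulC corner_mul1 corner_mulD.

End Corner.

Section CornerMap.
Variables (R S : comPzRingType) (f : {rmorphism R -> S}).

Lemma idem_map_subproof (e : idem R) : f (ival e) * f (ival e) = f (ival e).
Proof. by rewrite -rmorphM idemP. Qed.

Definition idem_map (e : idem R) : idem S := Idem (idem_map_subproof e).

Variables (e : idem R) (e' : idem S) (ee' : f (ival e) = ival e').

Lemma corner_map_subproof (x : corner e) : in_corner e' (f (val x)).
Proof. by rewrite /in_corner -ee' -rmorphM cornerE. Qed.

Definition corner_map (x : corner e) : corner e' :=
  Corner (corner_map_subproof x).

Lemma corner_map_zmod : zmod_morphism corner_map.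
Proof. by move=> x y; apply: val_inj; rewrite /= rmorphB. Qed.
HB.instance Definition _ :=
  GRing.isZmodMorphism.Build (corner e) (corner e') corner_map corner_map_zmod.
Lemma corner_map_monoid : monoid_morphism corner_map.
Proof. by split=> [|x y]; apply: val_inj; rewrite /= ?rmorphM. Qed.
HB.instance Definition _ :=
  GRing.isMonoidMorphism.Build (corner e) (corner e') corner_map
    corner_map_monoid.

End CornerMap.

(* The disjoint union. An R-point of X |_| Y is a decomposition               *)
(* Spec R = Spec eR |_| Spec (1-e)R together with an eR-point of X and a      *)
(* (1-e)R-point of Y. No data is recorded over a factor that is the zero ring,*)
(* over which a sheaf has exactly one point.                                  *)
Section Union.
Variables X Y : zfunctor.

Record union_pts (R : comPzRingType) := UnionPt {
  upart : idem R;
  uleft : ival upart != 0 -> X (corner upart);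
  uright : ival (idem_compl upart) != 0 -> Y (corner (idem_compl upart)) }.

Lemma union_eq R (p q : union_pts R) (E : idfun (ival (upart p)) = ival (upart q))
    (E' : idfun (ival (idem_compl (upart p))) =
      ival (idem_compl (upart q))) :
  (forall np nq, act (corner_map E : {rmorphism _ -> _}) (@uleft _ p np) =
     @uleft _ q nq) ->
  (forall np nq, act (corner_map E' : {rmorphism _ -> _}) (@uright _ p np) =
     @uright _ q nq) -> p = q.
Proof.
case: p q E E' => [[e ee] x y] [[e' ee'] x' y'] /= E.
case: _ / E in ee' x' y' *.
rewrite (Prop_irrelevance ee' ee) in x' y' * => E' Hx Hy.
have -> : x = x'.
  apply: funext => ne; rewrite -(Hx ne ne) actI // => z.
  exact: val_inj.
have -> : y = y'.
  apply: funext => ne; rewrite -(Hy ne ne) actI // => z.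
  exact: val_inj.
by [].
Qed.

Section Act.
Variables (R S : comPzRingType) (f : {rmorphism R -> S}).

Lemma idem_nz (e : idem R) (e' : idem S) :
  f (ival e) = ival e' -> ival e' != 0 -> ival e != 0.
Proof. by move=> <-; apply: contra_neq => ->; rewrite rmorph0. Qed.

Lemma idem_mapE (e : idem R) : f (ival e) = ival (idem_map f e).
Proof. by []. Qed.

Lemma idem_map_compl (e : idem R) :
  f (ival (idem_compl e)) = ival (idem_compl (idem_map f e)).
Proof. by rewrite /= rmorphB rmorph1. Qed.

Definition union_act (p : union_pts R) : union_pts S :=
  @UnionPt S (idem_map f (upart p))
    (fun ne => act (corner_map (idem_mapE (upart p)) : {rmorphism _ -> _})
                 (uleft (idem_nz (idem_mapE (upart p)) ne)))
    (fun ne => act (corner_map (idem_map_compl (upart p)) : {rmorphism _ -> _})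
                 (uright (idem_nz (idem_map_compl (upart p)) ne))).

End Act.

Lemma union_actI (R : comPzRingType) (f : {rmorphism R -> R}) p : f =1 id -> union_act f p = p.
Proof.
move=> fid; have E : idfun (ival (upart (union_act f p))) = ival (upart p) by rewrite /= fid.
have E' : idfun (ival (idem_compl (upart (union_act f p)))) =
    ival (idem_compl (upart p)).
  by rewrite /= fid.
apply: (union_eq (E := E) (E' := E')) => np nq /=.
  rewrite (bool_irrelevance (idem_nz _ np) nq).
  set g := corner_map E; set h := corner_map _.
  rewrite -(@actM _ _ _ _ h g (g \o h)) // actI // => z.
  by apply: val_inj; rewrite /= fid.
rewrite (bool_irrelevance (idem_nz _ np) nq).
set g := corner_map E'; set h := corner_map _.
rewrite -(@actM _ _ _ _ h g (g \o h)) // actI // => z.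
by apply: val_inj; rewrite /= fid.
Qed.

Lemma union_actM (R S T : comPzRingType) (f : {rmorphism R -> S}) (g : {rmorphism S -> T})
    (h : {rmorphism R -> T}) p :
  h =1 g \o f -> union_act h p = union_act g (union_act f p).
Proof.
move=> hgf.
have E : idfun (ival (upart (union_act h p))) =
    ival (upart (union_act g (union_act f p))) by rewrite /= hgf.
have E' : idfun (ival (idem_compl (upart (union_act h p)))) =
    ival (idem_compl (upart (union_act g (union_act f p)))) by rewrite /= hgf.
apply: (union_eq (E := E) (E' := E')) => np nq /=.
  set a := corner_map _; set b := corner_map _; set c := corner_map _.
  set d := corner_map _.
  rewrite -(@actM _ _ _ _ b a (a \o b)) //.
  rewrite (bool_irrelevance (idem_nz _ _) (idem_nz (idem_mapE h (upart p)) np)).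
  by apply: actM => z; apply: val_inj; rewrite /= hgf.
set a := corner_map _; set b := corner_map _; set c := corner_map _.
set d := corner_map _.
rewrite -(@actM _ _ _ _ b a (a \o b)) //.
rewrite (bool_irrelevance (idem_nz _ (idem_nz _ nq))
  (idem_nz (idem_map_compl h (upart p)) np)).
by apply: actM => z; apply: val_inj; rewrite /= hgf.
Qed.

Definition zunion : zfunctor := ZFunctor union_actI union_actM.

End Union.

Section Inl.
Variables X Y : zfunctor.

Section ToCorner.
Variables (R : comPzRingType) (e : idem R).

Lemma to_corner_subproof (x : R) : in_corner e (x * ival e).
Proof. by rewrite /in_corner -mulrA idemP. Qed.

Definition to_corner (x : R) : corner e := Corner (to_corner_subproof x).

Lemma to_corner_zmod : zmod_morphism to_corner.
Proof. by move=> x y; apply: val_inj; rewrite /= mulrBl. Qed.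
HB.instance Definition _ :=
  GRing.isZmodMorphism.Build R (corner e) to_corner to_corner_zmod.
Lemma to_corner_monoid : monoid_morphism to_corner.
Proof.
split=> [|x y]; apply: val_inj; rewrite /= ?mul1r //.
by rewrite mulrACA idemP.
Qed.
HB.instance Definition _ :=
  GRing.isMonoidMorphism.Build R (corner e) to_corner to_corner_monoid.

End ToCorner.

Definition idem1 (R : comPzRingType) : idem R := Idem (mulr1 (1 : R)).

Lemma idem1_compl (R : comPzRingType) : ~ ival (idem_compl (idem1 R)) != 0.
Proof. by rewrite /= subrr eqxx. Qed.

Definition inl_fun (R : comPzRingType) (x : X R) : union_pts X Y R :=
  @UnionPt X Y R (idem1 R)
    (fun=> act (to_corner (idem1 R) : {rmorphism _ -> _}) x)
    (fun ne => False_rect _ (idem1_compl ne)).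

Lemma inl_nat (R S : comPzRingType) (f : {rmorphism R -> S}) (x : X R) :
  @inl_fun S (act f x) = @act (zunion X Y) R S f (@inl_fun R x).
Proof.
have E : idfun (ival (upart (@inl_fun S (act f x)))) =
    ival (upart (@act (zunion X Y) R S f (@inl_fun R x))).
  by rewrite /= rmorph1.
have E' : idfun (ival (idem_compl (upart (@inl_fun S (act f x))))) =
    ival (idem_compl (upart (@act (zunion X Y) R S f (@inl_fun R x)))).
  by rewrite /= rmorph1.
apply: (union_eq (E := E) (E' := E')) => np nq; last by case: (idem1_compl np).
rewrite /=; set a := corner_map _; set b := to_corner _.
set c := corner_map _; set d := to_corner _.
rewrite -(@actM _ _ _ _ d c (c \o d)) // -(@actM _ _ _ _ f b (b \o f)) //.
rewrite -(@actM _ _ _ _ (b \o f) a (c \o d)) // => z.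
by apply: val_inj; rewrite /= !mulr1.
Qed.

Definition zinl : zmor X (zunion X Y) := @ZMor X (zunion X Y) inl_fun inl_nat.

End Inl.

Lemma zempty_act (R S : comPzRingType) (f : {rmorphism R -> S}) :
  1 = 0 :> R -> 1 = 0 :> S.
Proof. by move=> R0; rewrite -(rmorph1 f) R0 rmorph0. Qed.

Definition zempty : zfunctor :=
  @ZFunctor (fun R => 1 = 0 :> R) zempty_act
    (fun _ _ _ _ => Prop_irrelevance _ _)
    (fun _ _ _ _ _ _ _ _ => Prop_irrelevance _ _).

(* B |_| P 0 |_| ... |_| P (N - 1) *)
Fixpoint union_upto (B : zfunctor) (P : nat -> zfunctor) (N : nat) : zfunctor :=
  if N is M.+1 then zunion (union_upto B P M) (P M) else B.

(* (A^m \ 0) x ... x (A^2 \ 0) x (A^1 \ 0) *)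
Definition punctured_flag (m : nat) : zfunctor :=
  @zprodn m (fun i => punctured_affine i.+1).

Section AffineLine.

Lemma unimodular_exp (R : comPzRingType) (n : nat) (a : 'I_n -> R) (m : nat) :
  (exists b, \sum_(i < n) b i * a i = 1) ->
  exists c, \sum_(i < n) c i * a i ^+ m = 1.
Proof.
move=> unim_a.
suff H : forall k, (k <= n)%N ->
    exists c, \sum_(i < n) c i * a i ^+ (if i < k then m else 1)%N = 1.
  by have [c c1] := H n (leqnn n); exists c; rewrite -c1;
    apply: eq_bigr => i _; rewrite ltn_ord.
elim=> [_|k IHk ltkn]; first by case: unim_a => b; exists b.
have [c] := IHk (ltnW ltkn); pose j := Ordinal ltkn.
rewrite (bigD1 j) //= ltnn expr1; set s := c j * a j; set t := \sum_(i < n | _) _.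
move=> st1; have : 1 = s ^+ m + t * \sum_(i < m) s ^+ i.
  have -> : t = - (s - 1) by rewrite -st1 opprB addrAC subrr add0r.
  by rewrite mulNr -subrX1 opprB addrC subrK.
set w := \sum_(i < m) _ => e1.
exists (fun i => if i == j then c j ^+ m else w * c i).
rewrite (bigD1 j) //= eqxx ltnSn -exprMn e1; congr (_ + _).
rewrite mulrC mulr_sumr; apply: eq_bigr => i ij.
rewrite (negPf ij) -mulrA; congr (_ * (_ * a i ^+ _)).
by rewrite ltnS leq_eqVlt -[k]/(val j) (inj_eq val_inj) (negPf ij).
Qed.

Lemma localization_mono (R S : comPzRingType) (f : {rmorphism R -> S}) (a : R) :
  is_localization f a -> forall r, f r = 0 ->
  exists n, forall N, (n <= N)%N -> a ^+ N * r = 0.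
Proof.
move=> [_ _ inj] r /inj[n an0]; exists n => N nN.
by rewrite -(subnK nN) exprD -mulrA an0 mulr0.
Qed.

Lemma ring_sheaf (R : comPzRingType) (n : nat) (a : 'I_n -> R)
    (S : 'I_n -> comPzRingType) (loc : forall i, {rmorphism R -> S i})
    (T : 'I_n -> 'I_n -> comPzRingType)
    (l : forall i j, {rmorphism S i -> T i j})
    (r : forall i j, {rmorphism S j -> T i j}) :
  (exists b : 'I_n -> R, \sum_(i < n) b i * a i = 1) ->
  (forall i, is_localization (loc i) (a i)) ->
  (forall i j, l i j \o loc i =1 r i j \o loc j) ->
  (forall i j,
    is_localization (l i j \o loc i : {rmorphism R -> T i j}) (a i * a j)) ->
  forall x : forall i, S i, (forall i j, l i j (x i) = r i j (x j)) ->
  exists! y, forall i, loc i y = x i.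
Proof.
move=> unim locP lr TP x lx.
have sep y : (forall i, loc i y = 0) -> y = 0.
  move=> y0.
  have /choice[N NP] i := localization_mono (locP i) (y0 i).
  have [c c1] := unimodular_exp (\max_i N i)%N unim.
  rewrite -[y]mul1r -c1 mulr_suml big1 // => i _.
  by rewrite -mulrA NP ?mulr0 // leq_bigmax.
have [y yx] : exists y, forall i, loc i y = x i; last first.
  exists y; split=> // z zx; apply/eqP; rewrite -subr_eq0; apply/eqP.
  by apply: sep => i; rewrite rmorphB /= yx zx subrr.
have /choice[N NP] i : exists N, exists b, loc i (a i) ^+ N * x i = loc i b.
  by case: (locP i) => _ /(_ (x i)).
pose N0 := (\max_i N i)%N.
have /choice[b bP] i : exists b, loc i (a i) ^+ N0 * x i = loc i b.
  have [b e] := NP i; exists (a i ^+ (N0 - N i) * b).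
  rewrite rmorphM rmorphXn -e mulrA -exprD subnK //; exact: leq_bigmax.
have TZ i j : exists M, forall K, (M <= K)%N ->
    (a i * a j) ^+ K * (a j ^+ N0 * b i - a i ^+ N0 * b j) = 0.
  apply: (localization_mono (TP i j)).
  rewrite /= !(rmorphB, rmorphM, rmorphXn) /= -bP.
  have -> : l i j (loc i (b j)) = r i j (loc j (a j)) ^+ N0 * r i j (x j).
    by rewrite (lr i j (b j) : l i j (loc i (b j)) = _) /= -bP rmorphM rmorphXn.
  rewrite rmorphM rmorphXn /= -lx.
  have -> : l i j (loc i (a j)) = r i j (loc j (a j)) := lr i j (a j).
  by rewrite mulrCA subrr.
have /choice[M MP] ij := TZ ij.1 ij.2.
pose M0 := (\max_ij M ij)%N.
have ab i j : a j ^+ (M0 + N0) * (a i ^+ M0 * b i) =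
    a i ^+ (M0 + N0) * (a j ^+ M0 * b j).
  apply/eqP; rewrite -subr_eq0 -(MP (i, j) M0); last exact: (leq_bigmax (i, j)).
  rewrite exprMn !exprD mulrBr /=; apply/eqP; congr (_ - _).
    by rewrite mulrACA [a j ^+ M0 * _]mulrC.
  by rewrite mulrACA.
have [c c1] := unimodular_exp (M0 + N0) unim.
exists (\sum_j c j * (a j ^+ M0 * b j)) => i.
have e : a i ^+ (M0 + N0) * (\sum_j c j * (a j ^+ M0 * b j)) = a i ^+ M0 * b i.
  rewrite mulr_sumr -[RHS]mul1r -c1 mulr_suml; apply: eq_bigr => j _.
  by rewrite mulrCA -ab !mulrA.
have [u u1] : exists u, loc i (a i) * u = 1 by case: (locP i).
have {}u1 : u ^+ (M0 + N0) * loc i (a i) ^+ (M0 + N0) = 1.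
  by rewrite -exprMn mulrC u1 expr1n.
rewrite -[LHS]mul1r -u1 -mulrA -rmorphXn -rmorphM e rmorphM rmorphXn -bP.
by rewrite [X in _ * X]mulrA -exprD mulrA u1 mul1r.
Qed.

Lemma affine1_sheaf : zariski_sheaf (affine 1).
Proof.
move=> R n a S loc T l r unim locP lr TP x lx.
have [|y [yx uy]] := @ring_sheaf R n a S loc T l r unim locP lr TP
  (fun i => (x i : 'rV_1) 0 0).
  by move=> i j; have := lx i j => /= /rowP/(_ 0); rewrite !mxE.
exists (const_mx y); split=> [i|z zx].
  by apply/rowP => j; rewrite !mxE ord1 yx.
apply/rowP => j; rewrite !mxE ord1; apply: uy => i.
by have /rowP/(_ 0) := zx i; rewrite !mxE.
Qed.

Lemma mpoly_eval (R : comPzRingType) (n : nat) (v : 'I_n -> R) :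
  exists f : {rmorphism {mpoly int[n]} -> R}, forall i, f 'X_i = v i.
Proof.
have [R0|R1] := eqVneq (1 : R) 0.
  have z (x y : R) : x = y by rewrite -[x]mul1r -[y]mul1r R0 !mul0r.
  pose c (p : {mpoly int[n]}) : R := 0.
  have cN : zmod_morphism c by move=> p q; apply: z.
  have cM : monoid_morphism c by split=> [|p q]; apply: z.
  pose c1 := GRing.isZmodMorphism.Build _ _ c cN.
  pose c2 := GRing.isMonoidMorphism.Build _ _ c cM.
  pose f : {rmorphism {mpoly int[n]} -> R} := HB.pack c c1 c2.
  by exists f => i; apply: z.
pose m := GRing.PzSemiRing_isNonZero.Build R R1.
pose S : comNzRingType := HB.pack (GRing.ComPzRing.sort R) R m.
pose w : 'I_n -> S := v.
pose f : {rmorphism {mpoly int[n]} -> S} := mmap intr w.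
by exists (f : {rmorphism {mpoly int[n]} -> R}) => i; rewrite /= mmapX mmap1U.
Qed.

Lemma mpoly_eval_unique (R : comPzRingType) (n : nat)
    (f g : {rmorphism {mpoly int[n]} -> R}) :
  (forall i, f 'X_i = g 'X_i) -> f =1 g.
Proof.
move=> fg p; elim/mpolyind: p => [|c m p _ _ IHp]; first by rewrite !rmorph0.
rewrite !rmorphD IHp -mul_mpolyC !rmorphM -[c]intz.
rewrite !rmorph_int mpolyXE_id !rmorph_prod; congr (_ * _ + _).
by apply: eq_bigr => i _; rewrite !rmorphXn fg.
Qed.

Definition affine1_chart_fun (R : comPzRingType)
  (x : zspec {mpoly int[1]} R) : affine 1 R :=
  const_mx ((x : {rmorphism _ -> _}) 'X_0).

Lemma affine1_chart_nat (R S : comPzRingType) (f : {rmorphism R -> S})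
    (x : zspec {mpoly int[1]} R) :
  affine1_chart_fun (act f x) = act f (affine1_chart_fun x).
Proof. by apply/rowP => i; rewrite !mxE. Qed.

Definition affine1_chart : zmor (zspec {mpoly int[1]}) (affine 1) :=
  ZMor affine1_chart_nat.

Lemma affine1_chart_surj (R : comPzRingType) (v : affine 1 R) :
  image_of affine1_chart v.
Proof.
have [f fv] := @mpoly_eval R 1 (fun=> (v : 'rV[R]_1) 0 0).
by exists f; apply/rowP => i; rewrite !mxE fv ord1.
Qed.

Lemma affine1_variety : is_variety (affine 1).
Proof.
split; first exact: affine1_sheaf.
  exists 1%N, (fun=> {mpoly int[1]} : comPzRingType), (fun=> affine1_chart).
  split=> [_|K x]; last by exists ord0; exact: (affine1_chart_surj x).
  split; first by exists 1%N, (idfun : {rmorphism _ -> _}) => a; exists a.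
  split=> [R f g /rowP/(_ 0)|R x].
    rewrite !mxE => fg; apply: rmorphism_ext.
    by apply: mpoly_eval_unique => i; rewrite ord1.
  exists (fun=> True) => S f; split=> _; last exact: (affine1_chart_surj (act f x)).
  exists 1%N, (fun=> 1), (fun=> 1); split=> [_|].
    by exists 1; rewrite ?rmorph1.
  by rewrite big_ord1 mulr1.
move=> R x y; exists (fun r => r = (x : 'rV_1) 0 0 - (y : 'rV_1) 0 0) => S f.
split=> [/rowP/(_ 0) xy _ ->|/(_ _ erefl)]; rewrite ?rmorphB.
  by move: xy; rewrite !mxE => ->; rewrite subrr.
move=> /eqP; rewrite subr_eq0 => /eqP xy.
by apply/rowP => i; rewrite !mxE ord1.
Qed.

End AffineLine.

(* The immersed subvarieties Z i partition X: every point of X with values in *)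
(* a field comes from exactly one of them.                                    *)
Definition partitioned_by (X : zfunctor) (n : nat) (Z : 'I_n -> zfunctor)
    (f : forall i, zmor (Z i) X) :=
  (forall i, immersion (f i)) /\
  (forall K : fieldType,
    bijective (fun p : {i : 'I_n & Z i K} => f (tag p) K (tagged p))).

Definition piecewise_isomorphic (X Y : zfunctor) :=
  exists (n : nat) (Z : 'I_n -> zfunctor)
    (f : forall i, zmor (Z i) X) (g : forall i, zmor (Z i) Y),
    [/\ forall i, is_variety (Z i), partitioned_by f & partitioned_by g].

(* A morphism from the disjoint union of the tori G_m^(k_j), k_j in s, is     *)
(* the family of its restrictions to these tori.                              *)
Definition geometric_torification (X : zfunctor) (s : seq nat) :=
  exists e : forall j : 'I_(size s), zmor (torus (nth 0%N s j)) X,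
    partitioned_by e.

Definition counting_polynomial (X : zfunctor) (P : {poly int}) :=
  forall F : finFieldType, exists (c : nat) (h : 'I_c -> X F),
    bijective h /\ c%:Z = P.[#|F|%:Z].

(* The Grothendieck ring of varieties, as the ring generated by the classes   *)
(* of varieties with K0_eq as the equality imposed by the relations.          *)
(* It cannot be a quotient in pzRingType: schemes range over all rings, so    *)
(* that K0_expr lives in a larger universe than the carriers of rings.        *)

Inductive K0_expr :=
| K0_class (X : zfunctor) of is_variety X
| K0_zero
| K0_one
| K0_opp of K0_expr
| K0_add of K0_expr & K0_expr
| K0_mul of K0_expr & K0_expr.

Inductive K0_eq : K0_expr -> K0_expr -> Prop :=
| K0_refl a : K0_eq a a
| K0_sym a b : K0_eq a b -> K0_eq b a
| K0_trans a b c : K0_eq a b -> K0_eq b c -> K0_eq a c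
| K0_oppE a b : K0_eq a b -> K0_eq (K0_opp a) (K0_opp b)
| K0_addE a b c d :
    K0_eq a b -> K0_eq c d -> K0_eq (K0_add a c) (K0_add b d)
| K0_mulE a b c d :
    K0_eq a b -> K0_eq c d -> K0_eq (K0_mul a c) (K0_mul b d)
| K0_addA a b c : K0_eq (K0_add a (K0_add b c)) (K0_add (K0_add a b) c)
| K0_addC a b : K0_eq (K0_add a b) (K0_add b a)
| K0_add0 a : K0_eq (K0_add K0_zero a) a
| K0_addN a : K0_eq (K0_add (K0_opp a) a) K0_zero
| K0_mulA a b c : K0_eq (K0_mul a (K0_mul b c)) (K0_mul (K0_mul a b) c)
| K0_mulC a b : K0_eq (K0_mul a b) (K0_mul b a)
| K0_mul1 a : K0_eq (K0_mul K0_one a) a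
| K0_mulD a b c :
    K0_eq (K0_mul (K0_add a b) c) (K0_add (K0_mul a c) (K0_mul b c))
| K0_iso X Y (hX : is_variety X) (hY : is_variety Y) :
    isomorphic X Y -> K0_eq (K0_class hX) (K0_class hY)
| K0_scissors X Y U (hX : is_variety X) (hY : is_variety Y)
    (hU : is_variety U) (i : zmor Y X) :
    closed_immersion i -> isomorphic U (complement (image_of i)) ->
    K0_eq (K0_class hX) (K0_add (K0_class hY) (K0_class hU))
| K0_product X Y P (hX : is_variety X) (hY : is_variety Y)
    (hP : is_variety P) :
    isomorphic P (zprod X Y) ->
    K0_eq (K0_class hP) (K0_mul (K0_class hX) (K0_class hY))
| K0_point X (hX : is_variety X) :
    isomorphic X (affine 0) -> K0_eq (K0_class hX) K0_one.

Definition K0_L : K0_expr := K0_class affine1_variety.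

Definition K0_int (n : int) : K0_expr :=
  match n with
  | Posz m => iter m (K0_add K0_one) K0_zero
  | Negz m => K0_opp (iter m.+1 (K0_add K0_one) K0_zero)
  end.

(* P(L) *)
Definition K0_poly (P : {poly int}) : K0_expr :=
  foldr (fun c a => K0_add (K0_int c) (K0_mul K0_L a)) K0_zero P.

(* [X] = P(L) *)
Definition has_class (X : zfunctor) (P : {poly int}) :=
  exists hX : is_variety X, K0_eq (K0_class hX) (K0_poly P).

(* The Habiro ring lim_n Z[t] / ((t - 1) ... (t^n - 1)).  It is used with     *)
(* t = q, where (1 - q) ... (1 - q^n) generates the same ideal, and with      *)
(* t = L: counting points shows that L is transcendental over Z, so that      *)
(* Z[L] is a polynomial ring.                                                 *)

(* (t^n - 1) ... (t - 1) *)
Definition qfact (n : nat) : {poly int} := \prod_(i < n) ('X ^+ i.+1 - 1).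

Record habiro := Habiro {
  residue : forall n : nat, {poly %/ qfact n.+1};
  residue_coherent : forall n : nat,
    residue n = in_qpoly (qfact n.+1) (residue n.+1 : {poly int}) }.

(* P 1, P 2, ... have the residues of x modulo qfact 1, qfact 2, ... *)
Definition determines (P : nat -> {poly int}) (x : habiro) :=
  forall n, residue x n = in_qpoly (qfact n.+1) (P n.+1).

Definition habiro_partial_sum (alpha : nat -> {poly int}) (N : nat) :=
  \sum_(m < N) alpha m * qfact m.

(* x = \sum_(m >= 0) alpha m * qfact m; modulo qfact n the terms with m >= n  *)
(* vanish.                                                                    *)
Definition habiro_series (alpha : nat -> {poly int}) (x : habiro) :=
  forall n M, (n < M)%N ->
    residue x n = in_qpoly (qfact n.+1) (habiro_partial_sum alpha M).

(* The systems are indexed by N >= 1: stage 0 is never looked at.             *)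
Record ind_system := IndSystem {
  stage :> nat -> zfunctor;
  transition : forall N, zmor (stage N) (stage N.+1) }.

Definition is_ind_variety (X : ind_system) :=
  forall N, (0 < N)%N ->
    is_variety (X N) /\ closed_immersion (transition X N).

Definition F1_structure (X : ind_system) :=
  is_ind_variety X /\
  exists (Y : nat -> zfunctor) (k : nat -> seq nat),
    let alpha m : {poly int} := \sum_(j <- k m) ('X - 1) ^+ j in
    [/\ forall m, is_variety (Y m) /\ geometric_torification (Y m) (k m),
        forall N, (0 < N)%N -> piecewise_isomorphic (X N)
          (union_upto zempty (fun m => zprod (Y m) (punctured_flag m)) N),
        (forall m, has_class (Y m) (alpha m)) /\
        (exists P, (forall N, (0 < N)%N -> has_class (X N) (P N)) /\
          exists x, determines P x /\ habiro_series alpha x)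
      & (forall m, counting_polynomial (Y m) (alpha m)) /\
        (exists P, (forall N, (0 < N)%N -> counting_polynomial (X N) (P N)) /\
          exists x, determines P x /\ habiro_series alpha x)].

(* The polynomial N_(X_n) is unique, having prescribed values at all prime    *)
(* powers.                                                                    *)
Definition Fzeta_structure (X : ind_system) (zeta : algC) :=
  F1_structure X /\
  exists n, n.-primitive_root zeta /\
    exists P, counting_polynomial (X n) P /\ 0 <= P.[1 - n%:Z].

Definition X_sigma : ind_system :=
  @IndSystem
    (union_upto (affine 0) (fun m => zprod (affine m.+1) (punctured_flag m)))
    (fun N => zinl _ _).

Definition N_sigma (n : nat) : {poly int} :=
  1 + \sum_(m < n) 'X ^+ m.+1 * \prod_(i < m) ('X ^+ i.+1 - 1).

(* Main.v *)
From Stdlib Require Import Setoid Morphisms Ring.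
Require Import Defs.
From HB Require Import structures.
From mathcomp Require Import all_boot all_order all_algebra all_field.
From mathcomp Require Import ring_quotient boolp mpoly.

(** The point counts and the classes in the Grothendieck ring are computed
    together. Both are invariants that are multiplicative on products and
    additive along a closed subscheme and its complement ([motivic],
    [counting_motivic], [K0_motivic]). Such an invariant takes the value X^n on
    A^n, hence X^n - 1 on A^n without the origin and the q-factorial on the
    product of these, and so it takes the value N_sigma N on the N-th stage of
    X_sigma ([motivic_sigma]).

    The invariants are defined on varieties, so the schemes above have to be
    shown to be sheaves, separated, and covered by finitely many affine schemes
    of finite type. The latter are the closed subschemes of affine spaces
    ([closed_affine_ft], [zspec_closed_immersion]), which makes products easy.
    A point belongs to the complement of a closed subscheme exactly if the
    ideal that this subscheme cuts out is the unit ideal ([complementP]), and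
    this is a local condition. A point of a disjoint union over R is an
    idempotent e with a point of one summand over eR and a point of the other
    over (1 - e)R; every question about it is answered on the two corners
    ([union_corner_eq], [sheaf_corner_glue]).

    For the F_1-structure, write N_sigma as the sum of alpha_m (X^m - 1) ... (X
    - 1) with alpha_0 = 1 + X and alpha_m = X^(m+1) for m > 0. This is the
    decomposition of X_sigma with X_0 the disjoint union of A^0 and A^1, and
    X_m = A^(m+1) ([isomorphic_sigma]). The affine space A^n is torified by the
    loci where a given set A of coordinates is invertible and the other
    coordinates vanish ([affine_partition]), in accordance with X^n being the
    sum of the (X - 1)^|A|. Later terms of N_sigma are divisible by more and
    more of the polynomials X^i - 1, so N_sigma has a limit in the Habiro ring
    ([N_sigma_mod]).

    For the inequality, let q = 1 - n with n at least 3. The quotient of two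
    consecutive terms of N_sigma at q is q (q^(m+1) - 1), of absolute value at
    least 2, so the last term dominates the sum of all the others
    ([N_sigma_le_term]). The quotients are alternately positive and negative,
    so the signs of the terms are periodic with period four ([term_sign]), and
    the last term is positive for n congruent to 0 or 3 modulo 4. *)

Set Implicit Arguments.
Unset Strict Implicit.
Unset Printing Implicit Defensive.

Import Order.TTheory GRing.Theory Num.Theory.
Local Open Scope ring_scope.

(** * Natural maps and isomorphisms *)

Lemma bij_inj_surj (A B : Type) (f : A -> B) :
  injective f -> (forall b, exists a, f a = b) -> bijective f.
Proof.
move=> finj /choice[g fg]; exists g => // a.
by apply: finj; rewrite fg.
Qed.

Definition zid (X : zfunctor) : zmor X X :=
  @ZMor X X (fun _ x => x) (fun _ _ _ _ => erefl).

Lemma zcomp_nat (X Y Z : zfunctor) (g : zmor Y Z) (f : zmor X Y)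
    (R S : comPzRingType) (h : {rmorphism R -> S}) (x : X R) :
  g S (f S (act h x)) = act h (g R (f R x)).
Proof. by rewrite !mor_nat. Qed.

Definition zcomp (X Y Z : zfunctor) (g : zmor Y Z) (f : zmor X Y) : zmor X Z :=
  ZMor (zcomp_nat g f).

(** The pointwise inverses of a natural bijection are natural. *)
Lemma isomorphic_bij (X Y : zfunctor) (f : zmor X Y) :
  (forall R, injective (f R)) -> (forall R (y : Y R), image_of f y) ->
  isomorphic X Y.
Proof.
move=> finj fsurj.
pose g R (y : Y R) := sval (cid (fsurj R y)).
have fg R (y : Y R) : f R (g R y) = y by rewrite /g; case: cid.
have g_nat (R S : comPzRingType) (h : {rmorphism R -> S}) (y : Y R) :
  g S (act h y) = act h (g R y) by apply: finj; rewrite mor_nat !fg.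
by exists f, (ZMor g_nat) => R; split=> z /=; [apply: finj|]; rewrite fg.
Qed.

Lemma isomorphicP (X Y : zfunctor) : isomorphic X Y ->
  exists f : zmor X Y,
    (forall R, injective (f R)) /\ (forall R (y : Y R), image_of f y).
Proof.
move=> [f [g fg]]; exists f; split=> [R|R y]; first exact: can_inj (fg R).1.
by exists (g R y); rewrite (fg R).2.
Qed.

Lemma isomorphic_sym (X Y : zfunctor) : isomorphic X Y -> isomorphic Y X.
Proof. by move=> [f [g fg]]; exists g, f => R; case: (fg R). Qed.

Lemma isomorphic_refl (X : zfunctor) : isomorphic X X.
Proof. by exists (zid X), (zid X). Qed.

Lemma isomorphic_trans (X Y Z : zfunctor) :
  isomorphic X Y -> isomorphic Y Z -> isomorphic X Z.
Proof.
move=> [f [f' ff]] [g [g' gg]]; exists (zcomp g f), (zcomp f' g') => R /=.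
by have [? ?] := ff R; have [? ?] := gg R; split; exact: can_comp.
Qed.

Lemma act_id (X : zfunctor) (R : comPzRingType) (x : X R) :
  act (idfun : {rmorphism R -> R}) x = x.
Proof. exact: actI. Qed.

Lemma act_comp (X : zfunctor) (R S T : comPzRingType) (f : {rmorphism R -> S})
    (g : {rmorphism S -> T}) (x : X R) :
  act g (act f x) = act (g \o f : {rmorphism R -> T}) x.
Proof. exact/esym/actM. Qed.

Lemma act_ext (X : zfunctor) (R S : comPzRingType) (f g : {rmorphism R -> S})
    (x : X R) : f =1 g -> act f x = act g x.
Proof. by move=> /rmorphism_ext ->. Qed.

(** * Quotient rings *)

Definition ideal_span (R : comPzRingType) (I : R -> Prop) (r : R) :=
  exists (n : nat) (a b : 'I_n -> R),
    (forall i, I (a i)) /\ \sum_(i < n) b i * a i = r.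

Section IdealSpan.
Variables (R : comPzRingType) (I : R -> Prop).

Lemma ideal_span_gen r : I r -> ideal_span I r.
Proof.
by move=> Ir; exists 1%N, (fun=> r), (fun=> 1); split; rewrite ?big_ord1 ?mul1r.
Qed.

Lemma ideal_span0 : ideal_span I 0.
Proof.
by exists 0%N, (fun=> 0), (fun=> 0); split=> [[]//|]; rewrite big_ord0.
Qed.

Lemma ideal_spanD r s : ideal_span I r -> ideal_span I s -> ideal_span I (r + s).
Proof.
move=> [m [a [b [Ia <-]]]] [n [c [d [Ic <-]]]].
pose glue (u : 'I_m -> R) (v : 'I_n -> R) i :=
  match split i with inl j => u j | inr j => v j end.
exists (m + n)%N, (glue a c), (glue b d); rewrite /glue.
split=> [i|]; first by case: split.
rewrite big_split_ord /=; congr (_ + _); apply: eq_bigr => i _.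
  by rewrite -[lshift n i]/(unsplit (inl i)) unsplitK.
by rewrite -[rshift m i]/(unsplit (inr i)) unsplitK.
Qed.

Lemma ideal_spanM c r : ideal_span I r -> ideal_span I (c * r).
Proof.
move=> [m [a [b [Ia <-]]]]; exists m, a, (fun i => c * b i); split=> //.
by rewrite mulr_sumr; apply: eq_bigr => i _; rewrite mulrA.
Qed.

Lemma ideal_span_sum (J : finType) (F : J -> R) :
  (forall j, ideal_span I (F j)) -> ideal_span I (\sum_j F j).
Proof.
move=> FI; apply: big_ind => //; [exact: ideal_span0 | exact: ideal_spanD].
Qed.

Lemma ideal_span_ker (S : comPzRingType) (f : {rmorphism R -> S}) r :
  (forall i, I i -> f i = 0) -> ideal_span I r -> f r = 0.
Proof.
move=> fI [n [a [b [Ia <-]]]]; rewrite rmorph_sum big1 // => i _.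
by rewrite rmorphM (fI _ (Ia i)) mulr0.
Qed.

Lemma ideal_span_min (J : R -> Prop) r :
  (forall i, J i -> ideal_span I i) -> ideal_span J r -> ideal_span I r.
Proof.
move=> IJ [n [a [b [Ia <-]]]]; apply: ideal_span_sum => j.
exact/ideal_spanM/IJ/Ia.
Qed.

Definition ideal_mem : pred R := fun r => `[< ideal_span I r >].

Lemma ideal_mem_zmod_closed : zmod_closed ideal_mem.
Proof.
split=> [|x y]; rewrite !unfold_in; first exact/asboolP/ideal_span0.
move=> /asboolP Ix /asboolP Iy; apply/asboolP/ideal_spanD => //.
by rewrite -mulN1r; exact: ideal_spanM.
Qed.
HB.instance Definition _ :=
  GRing.isZmodClosed.Build R ideal_mem ideal_mem_zmod_closed.

Definition ideal_zmod : zmodClosed R := GRing.ZmodClosed.clone R ideal_mem _.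

(** Residue classes modulo the ideal that [I] generates. Membership in an ideal
    is a boolean predicate by excluded middle; the quotient may be the zero
    ring, and whether it is decides [complementP]. *)
Definition ring_quot := Quotient.quot ideal_zmod.
HB.instance Definition _ := GRing.Zmodule.on ring_quot.

Local Notation Q := ring_quot.
Definition quot_pi (r : R) : Q := \pi_(Quotient.quot ideal_zmod)%qT r.
Local Notation pi := quot_pi.

Definition quot_rep (q : Q) : R := repr (q : Quotient.quot ideal_zmod).

Lemma quot_repK q : pi (quot_rep q) = q.
Proof. exact: reprK. Qed.

Lemma quot_piP x y : pi x = pi y <-> ideal_span I (x - y).
Proof.
split=> [/eqP|h]; last apply/eqP; rewrite -(@Quotient.idealrBE R ideal_zmod).
  by move=> /asboolP.
exact/asboolP.
Qed.

Lemma quot_repr x : ideal_span I (quot_rep (pi x) - x).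
Proof. by apply/quot_piP; rewrite quot_repK. Qed.

Definition quot_mul (x y : Q) : Q := pi (quot_rep x * quot_rep y).

Lemma quot_piM x y : pi (x * y) = quot_mul (pi x) (pi y).
Proof.
apply/esym/quot_piP.
have -> : forall a b c d : R, a * b - c * d = b * (a - c) + c * (b - d).
  by move=> a b c d; rewrite !mulrBr (mulrC b a) (mulrC b c) addrA subrK.
by apply: ideal_spanD; apply/ideal_spanM/quot_repr.
Qed.

Lemma quot_mulA : associative quot_mul.
Proof.
move=> x y z; rewrite -[x]quot_repK -[y]quot_repK -[z]quot_repK.
by rewrite -!quot_piM mulrA.
Qed.
Lemma quot_mulC : commutative quot_mul.
Proof. by move=> x y; rewrite /quot_mul mulrC. Qed.
Lemma quot_mul1 : left_id (pi 1) quot_mul.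
Proof. by move=> x; rewrite -[x]quot_repK -quot_piM mul1r. Qed.
Lemma quot_piB x y : pi (x - y) = pi x - pi y.
Proof. exact: (raddfB \pi_(Quotient.quot ideal_zmod)%qT). Qed.
Lemma quot_piD x y : pi (x + y) = pi x + pi y.
Proof. exact: (raddfD \pi_(Quotient.quot ideal_zmod)%qT). Qed.
Lemma quot_mulD : left_distributive quot_mul +%R.
Proof.
move=> x y z; rewrite -[x]quot_repK -[y]quot_repK -[z]quot_repK.
by rewrite -quot_piD -!quot_piM mulrDl quot_piD.
Qed.

HB.instance Definition _ := GRing.Zmodule_isComPzRing.Build Q
  quot_mulA quot_mulC quot_mul1 quot_mulD.

End IdealSpan.

Lemma ring_quotient (R : comPzRingType) (I : R -> Prop) :
  exists (Q : comPzRingType) (pi : {rmorphism R -> Q}),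
    (forall q, exists r, pi r = q) /\ (forall r, pi r = 0 <-> ideal_span I r).
Proof.
pose pi : R -> ring_quot I := @quot_pi R I.
pose pB := GRing.isZmodMorphism.Build R (ring_quot I) pi (@quot_piB R I).
have piM : monoid_morphism pi by split=> // x y; exact: quot_piM.
pose pM := GRing.isMonoidMorphism.Build R (ring_quot I) pi piM.
pose f : {rmorphism R -> ring_quot I} := HB.pack pi pB pM.
exists (ring_quot I), f; split=> [q|r]; last first.
  have -> : (f r = 0) = (pi r = pi 0) by rewrite -(rmorph0 f).
  by rewrite quot_piP subr0.
by exists (quot_rep q); exact: quot_repK.
Qed.

Lemma rmorphism_factor (P A R : comPzRingType) (pi : {rmorphism P -> A})
    (h : {rmorphism P -> R}) :
  (forall a, exists p, pi p = a) -> (forall p, pi p = 0 -> h p = 0) ->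
  exists g : {rmorphism A -> R}, forall p, g (pi p) = h p.
Proof.
move=> /choice[s sK] ker.
have hE p q : pi p = pi q -> h p = h q.
  move=> e; apply/eqP; rewrite -subr_eq0 -rmorphB; apply/eqP/ker.
  by rewrite rmorphB e subrr.
pose g a := h (s a).
have gB : zmod_morphism g.
  by move=> x y; rewrite /g -rmorphB; apply: hE; rewrite rmorphB !sK.
have gM : monoid_morphism g.
  split=> [|x y]; first by rewrite /g -(rmorph1 h); apply: hE; rewrite rmorph1 sK.
  by rewrite /g -rmorphM; apply: hE; rewrite rmorphM !sK.
pose b := GRing.isZmodMorphism.Build A R g gB.
pose m := GRing.isMonoidMorphism.Build A R g gM.
exists (HB.pack g b m : {rmorphism A -> R}) => p /=.
by apply: hE; rewrite sK.
Qed.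

(** * Affine schemes of finite type *)

Definition zprod_map (X X' Y Y' : zfunctor) (f : zmor X X') (g : zmor Y Y') :
  zmor (zprod X Y) (zprod X' Y').
Proof.
exists (fun R p => (f R p.1, g R p.2)) => R S h [x y] /=.
by rewrite /zprod_act !mor_nat.
Defined.

Lemma isomorphic_prod (X X' Y Y' : zfunctor) :
  isomorphic X X' -> isomorphic Y Y' -> isomorphic (zprod X Y) (zprod X' Y').
Proof.
move=> /isomorphicP[f [finj fsurj]] /isomorphicP[g [ginj gsurj]].
apply: (@isomorphic_bij _ _ (zprod_map f g)) => R.
  by move=> [x y] [x' y'] /= [/finj-> /ginj->].
move=> [x y]; have [x' <-] := fsurj R x; have [y' <-] := gsurj R y.
by exists (x', y').
Qed.

Lemma closed_immersion_comp_iso (X Y Z : zfunctor) (h : zmor Y Z) (f : zmor X Y) :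
  (forall R, injective (h R)) -> (forall R z, @image_of _ _ h R z) ->
  closed_immersion f -> closed_immersion (zcomp h f).
Proof.
move=> hinj hsurj [finj fcl]; split=> [R x x' /= /hinj/finj//|R z _].
have [y <-] := hsurj R z; have [I IP] := fcl R y Logic.I; exists I => S k.
rewrite -IP; split=> [] [x]; rewrite -mor_nat /=; first by move/hinj; exists x.
by move=> <-; exists x.
Qed.

Lemma closed_immersion_prod (X X' Y Y' : zfunctor) (f : zmor X X')
    (g : zmor Y Y') :
  closed_immersion f -> closed_immersion g -> closed_immersion (zprod_map f g).
Proof.
move=> [finj fcl] [ginj gcl]; split=> [R [x y] [x' y'] /= [/finj-> /ginj->]//|].
move=> R [x y] _; have [I IP] := fcl R x Logic.I; have [J JP] := gcl R y Logic.I.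
exists (fun r => I r \/ J r) => S h; split=> [[[a b]]|IJ].
  move=> [xa yb] r [Ir|Jr]; [apply: (IP S h).1 => //|apply: (JP S h).1 => //].
    by exists a.
  by exists b.
have [a ax] : image_of f (act h x) by apply/IP => r Ir; apply: IJ; left.
have [b bY] : image_of g (act h y) by apply/JP => r Ir; apply: IJ; right.
by exists (a, b); rewrite /= ax bY.
Qed.

(** The identity of A^n, viewed as a point with values in the polynomial ring,
    of which all points of A^n are specializations. *)
Definition universal_point (n : nat) : affine n {mpoly int[n]} :=
  \row_i 'X_i.

Lemma universal_pointP (n : nat) (R : comPzRingType) (v : affine n R) :
  exists f : {rmorphism {mpoly int[n]} -> R}, act f (universal_point n) = v.
Proof.
have [f fv] := mpoly_eval (fun i => (v : 'rV[R]_n) 0 i).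
by exists f; apply/rowP => i; rewrite !mxE fv.
Qed.

Lemma universal_point_inj (n : nat) (R : comPzRingType)
    (f g : {rmorphism {mpoly int[n]} -> R}) :
  act f (universal_point n) = act g (universal_point n) -> f =1 g.
Proof.
by move=> /rowP fg; apply: mpoly_eval_unique => i; have := fg i; rewrite !mxE.
Qed.

(** Affine schemes of finite type over Z. *)
Definition affine_ft (X : zfunctor) :=
  exists A, finitely_generated A /\ isomorphic (zspec A) X.

Lemma affine_ft_iso (X Y : zfunctor) :
  isomorphic X Y -> affine_ft X -> affine_ft Y.
Proof.
move=> XY [A [Afg AX]]; exists A; split=> //; exact: isomorphic_trans AX XY.
Qed.

(** The ideal that cuts out [X] at the universal point of A^n is a system of
    equations for [X]. As every point of A^n specializes the universal one, it
    lies on [X] exactly if it kills these equations, that is, if it factors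
    through the quotient of the polynomial ring by them. *)
Lemma closed_affine_ft (n : nat) (X : zfunctor) (j : zmor X (affine n)) :
  closed_immersion j -> affine_ft X.
Proof.
move=> [jinj jcl]; have [I IP] := jcl _ (universal_point n) Logic.I.
have [A [pi [pi_surj pi_ker]]] := ring_quotient I.
exists A; split; first by exists n, pi.
pose pt (R : comPzRingType) (f : {rmorphism A -> R}) : affine n R :=
  act (f \o pi : {rmorphism _ -> _}) (universal_point n).
have toX (R : comPzRingType) (f : zspec A R) : exists x, j R x = pt R f.
  apply/IP => r Ir /=; rewrite (_ : pi r = 0) ?rmorph0 //.
  exact/pi_ker/ideal_span_gen.
pose F R f := sval (cid (toX R f)).
have jF R f : j R (F R f) = pt R f by rewrite /F; case: cid.
have F_nat (R S : comPzRingType) (h : {rmorphism R -> S}) (f : zspec A R) :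
    F S (act h f) = act h (F R f).
  apply: jinj; rewrite mor_nat !jF /pt act_comp; by apply: act_ext => p.
apply: (@isomorphic_bij _ _ (ZMor F_nat)) => R.
  move=> f g /= fg; apply: rmorphism_ext => a; have [p <-] := pi_surj a.
  suff /universal_point_inj : pt R f = pt R g by apply.
  by rewrite -!jF fg.
move=> x; have [h hx] := universal_pointP (j R x).
have hI r : I r -> h r = 0 by apply: (IP R h).1; exists x.
have [|f fpi] := @rmorphism_factor _ _ _ pi h pi_surj.
  by move=> p /pi_ker; exact: ideal_span_ker.
exists f; apply: jinj; rewrite [LHS]jF -hx; exact: (act_ext (X := affine n)).
Qed.

(** Generators of [A] serve as coordinates, and the relations between them as
    equations. *)
Lemma zspec_closed_immersion (A : comPzRingType) : finitely_generated A ->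
  exists n (j : zmor (zspec A) (affine n)), closed_immersion j.
Proof.
move=> [n [pi pi_surj]]; exists n.
have pt_nat (R S : comPzRingType) (h : {rmorphism R -> S}) (f : zspec A R) :
    act (act h f \o pi : {rmorphism _ -> _}) (universal_point n) =
    act h (act (f \o pi : {rmorphism _ -> _}) (universal_point n)).
  by rewrite act_comp; by apply: act_ext => p.
exists (ZMor pt_nat); split=> [R f g /= fg|R v _].
  apply: rmorphism_ext => a; have [p <-] := pi_surj a.
  exact: (universal_point_inj fg p).
have [h <-] := universal_pointP v.
exists (fun r => exists2 p, pi p = 0 & r = h p) => S f; split.
  move=> [g gfh] _ [p p0 ->]; rewrite act_comp in gfh.
  by rewrite -[LHS](universal_point_inj gfh p) /= p0 rmorph0.
move=> kill; have [|g gE] := @rmorphism_factor _ _ S pi (f \o h) pi_surj.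
  by move=> p p0; apply: kill; exists p.
exists g; rewrite act_comp; exact: (act_ext (X := affine n)).
Qed.

Definition affine_cat (m n : nat) :
  zmor (zprod (affine m) (affine n)) (affine (m + n)).
Proof.
exists (fun R p => row_mx p.1 p.2) => R S h [x y] /=.
by rewrite map_row_mx.
Defined.

Lemma affine_cat_inj m n R : injective (@affine_cat m n R).
Proof. by move=> [x y] [x' y'] /= /eq_row_mx[-> ->]. Qed.

Lemma affine_cat_surj m n R v : @image_of _ _ (@affine_cat m n) R v.
Proof.
by exists (lsubmx (v : 'rV_(m + n)), rsubmx (v : 'rV_(m + n))); exact: hsubmxK.
Qed.

(** A product of closed subschemes of A^m and A^n is closed in A^(m + n). This
    replaces the tensor product of the coordinate rings. *)
Lemma affine_ft_prod (X Y : zfunctor) :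
  affine_ft X -> affine_ft Y -> affine_ft (zprod X Y).
Proof.
move=> [A [Afg AX]] [B [Bfg BY]]; apply: affine_ft_iso (isomorphic_prod AX BY) _.
have [m [i icl]] := zspec_closed_immersion Afg.
have [n [j jcl]] := zspec_closed_immersion Bfg.
apply: (@closed_affine_ft _ _ (zcomp (@affine_cat m n) (zprod_map i j))).
apply: closed_immersion_comp_iso.
- exact: affine_cat_inj.
- exact: affine_cat_surj.
- exact: closed_immersion_prod.
Qed.

Lemma affine_ft_affine n : affine_ft (affine n).
Proof.
apply: (@closed_affine_ft n _ (zid _)); split=> [R x y //|R v _].
by exists (fun=> False) => S f; split=> // _; exists (act f v).
Qed.

(** * Ideals and localizations *)

Lemma ideal_span_mul (R : comPzRingType) (I J : R -> Prop) r s :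
  ideal_span I r -> ideal_span J s ->
  ideal_span (fun t => exists a b, [/\ I a, J b & t = a * b]) (r * s).
Proof.
move=> [m [a [b [Ia <-]]]] [n [c [d [Jc <-]]]]; rewrite mulr_suml.
apply: ideal_span_sum => i; rewrite mulr_sumr; apply: ideal_span_sum => j.
rewrite mulrACA; apply/ideal_spanM/ideal_span_gen.
by exists (a i), (c j).
Qed.

Lemma ideal_span_sub (R : comPzRingType) (I J : R -> Prop) r :
  (forall a, I a -> J a) -> ideal_span I r -> ideal_span J r.
Proof. by move=> IJ; apply: ideal_span_min => a /IJ; exact: ideal_span_gen. Qed.

Lemma ideal_span1P (R : comPzRingType) (a : R) :
  ideal_span (eq a) 1 <-> exists b, a * b = 1.
Proof.
split=> [[n [c [b [ca e]]]]|[b ab]].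
  exists (\sum_i b i); rewrite mulr_sumr -e; apply: eq_bigr => i _.
  by rewrite -ca mulrC.
by rewrite -ab mulrC; apply/ideal_spanM/ideal_span_gen.
Qed.

(** * Open immersions and affine covers *)

Lemma open_immersion_iso_comp (X Y Z : zfunctor) (f : zmor Y Z) (g : zmor X Y) :
  (forall R, injective (g R)) -> (forall R y, @image_of _ _ g R y) ->
  open_immersion f -> open_immersion (zcomp f g).
Proof.
move=> ginj gsurj [finj fop]; split=> [R x x' /= /finj/ginj//|R z].
have [I IP] := fop R z; exists I => S h; rewrite -IP.
split=> [] [x <-]; first by exists (g S x).
by have [y <-] := gsurj S x; exists y.
Qed.

Lemma open_immersion_comp_iso (X Y Z : zfunctor) (h : zmor Y Z) (f : zmor X Y) :
  (forall R, injective (h R)) -> (forall R z, @image_of _ _ h R z) ->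
  open_immersion f -> open_immersion (zcomp h f).
Proof.
move=> hinj hsurj [finj fop]; split=> [R x x' /= /hinj/finj//|R z].
have [y <-] := hsurj R z; have [I IP] := fop R y; exists I => S k.
rewrite -IP; split=> [] [x]; rewrite -mor_nat /=; first by move/hinj; exists x.
by move=> <-; exists x.
Qed.

(** The intersection of the open sets of two ideals is the open set of their
    product. *)
Lemma open_immersion_prod (X X' Y Y' : zfunctor) (f : zmor X X') (g : zmor Y Y') :
  open_immersion f -> open_immersion g -> open_immersion (zprod_map f g).
Proof.
move=> [finj fop] [ginj gop]; split=> [R [x y] [x' y'] /= [/finj-> /ginj->]//|].
move=> R [x y]; have [I IP] := fop R x; have [J JP] := gop R y.
exists (fun t => exists a b, [/\ I a, J b & t = a * b]) => S h.
split=> [[[a b] /= [ax bY]]|U].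
  have hI := (IP S h).1 (ex_intro _ a ax).
  have hJ := (JP S h).1 (ex_intro _ b bY).
  have := ideal_span_mul hI hJ; rewrite mulr1; apply: ideal_span_sub.
  move=> _ [a' [b' [[u Iu ->] [v Jv ->] ->]]].
  exists (u * v); last by rewrite rmorphM.
  by exists u, v.
have [a ax] : image_of f (act h x).
  apply/IP; apply: ideal_span_min U => _ [t [u [v [Iu Jv ->]]] ->].
  by rewrite rmorphM mulrC; apply/ideal_spanM/ideal_span_gen; exists u.
have [b bY] : image_of g (act h y).
  apply/JP; apply: ideal_span_min U => _ [t [u [v [Iu Jv ->]]] ->].
  by rewrite rmorphM; apply/ideal_spanM/ideal_span_gen; exists v.
by exists (a, b); rewrite /= ax bY.
Qed.

(** Charts may be indexed by any finite type and need only be isomorphic to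
    spectra. *)
Lemma affine_cover_fin (X : zfunctor) (J : finType) (Z : J -> zfunctor)
    (f : forall j, zmor (Z j) X) :
  (forall j, affine_ft (Z j) /\ open_immersion (f j)) ->
  (forall (K : fieldType) (x : X K), exists j, image_of (f j) x) ->
  finite_affine_cover X.
Proof.
move=> fP cov.
have chart j : exists A (g : zmor (zspec A) X), [/\ finitely_generated A,
    open_immersion g & forall R x, @image_of _ _ (f j) R x -> image_of g x].
  have [[A [Afg /isomorphicP[g [ginj gsurj]]]] fop] := fP j.
  exists A, (zcomp (f j) g); split=> //; first exact: open_immersion_iso_comp.
  by move=> R x [z <-]; have [a <-] := gsurj R z; exists a.
pose A j := sval (cid (chart j)).
pose g j : zmor (zspec (A j)) X := sval (cid (svalP (cid (chart j)))).
have gP j : [/\ finitely_generated (A j), open_immersion (g j)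
    & forall R x, @image_of _ _ (f j) R x -> image_of (g j) x].
  exact: svalP (cid (svalP (cid (chart j)))).
exists #|J|, (fun i => A (enum_val i)), (fun i => g (enum_val i)).
split=> [i|K x]; first by case: (gP (enum_val i)).
have [j /(let: And3 _ _ h := gP j in h K x) gx] := cov K x.
by exists (enum_rank j); rewrite enum_rankK.
Qed.

(** * Isomorphisms and products *)

Lemma variety_iso (X Y : zfunctor) :
  isomorphic X Y -> is_variety X -> is_variety Y.
Proof.
move=> XY [shX covX sepX].
have /isomorphicP[f [finj fsurj]] := XY.
have [g [ginj gsurj]] := isomorphicP (isomorphic_sym XY).
split.
- move=> R n a S loc T l r unim locP lr TP y ly.
  have [|x [xy xu]] := shX R n a S loc T l r unim locP lr TP (fun i => g _ (y i)).
    by move=> i j; rewrite -!mor_nat ly.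
  have [z gz] := gsurj R x.
  exists z; split=> [i|z' zy].
    by apply: ginj; rewrite mor_nat gz xy.
  by apply: ginj; rewrite gz; apply: xu => i; rewrite -mor_nat zy.
- have [n [A [h [hP cov]]]] := covX; exists n, A, (fun i => zcomp f (h i)).
  split=> [i|K y].
    have [Afg hop] := hP i; split=> //; exact: open_immersion_comp_iso.
  have [x <-] := fsurj K y; have [i [a <-]] := cov K x.
  by exists i, a.
- move=> R x y; have [I IP] := sepX R (g R x) (g R y); exists I => S h.
  by rewrite -IP -!mor_nat; split=> [->|/ginj].
Qed.

Lemma variety_prod (X Y : zfunctor) :
  is_variety X -> is_variety Y -> is_variety (zprod X Y).
Proof.
move=> [shX covX sepX] [shY covY sepY]; split.
- move=> R n a S loc T l r unim locP lr TP p lp.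
  have [|x [xp xu]] :=
    shX R n a S loc T l r unim locP lr TP (fun i => (p i).1).
    by move=> i j; have [] := lp i j.
  have [|y [yp yu]] :=
    shY R n a S loc T l r unim locP lr TP (fun i => (p i).2).
    by move=> i j; have [] := lp i j.
  exists (x, y); split=> [i|[x' y'] zp].
    by rewrite /= /zprod_act /= xp yp; case: (p i).
  by congr pair; [apply: xu => i|apply: yu => i]; rewrite -zp.
- have [m [A [f [fP covf]]]] := covX; have [n [B [g [gP covg]]]] := covY.
  apply: (@affine_cover_fin _ ('I_m * 'I_n)%type
    (fun ij => zprod (zspec (A ij.1)) (zspec (B ij.2)))
    (fun ij => zprod_map (f ij.1) (g ij.2))) => [[i j]|K [x y]].
    have [[? ?] [? ?]] := (fP i, gP j); split; last exact: open_immersion_prod.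
    apply: affine_ft_prod; [exists (A i)|exists (B j)]; split=> //;
      exact: isomorphic_refl.
  have [[i [a <-]] [j [b <-]]] := (covf K x, covg K y).
  by exists (i, j), (a, b).
- move=> R [x y] [x' y'].
  have [I IP] := sepX R x x'; have [J JP] := sepY R y y'.
  exists (fun r => I r \/ J r) => S f.
  split=> [[/IP fI /JP fJ] r [/fI|/fJ]//|fIJ].
  rewrite /= /zprod_act /=.
  by congr pair; [apply/IP|apply/JP] => r ?; apply: fIJ; [left|right].
Qed.

(** * Open complements *)

Lemma nonzero_comNzRing (Q : comPzRingType) : (1 : Q) != 0 ->
  exists S : comNzRingType, (S : comPzRingType) = Q.
Proof.
case: Q => T c Q1; set Q := GRing.ComPzRing.Pack c in Q1 *.
pose m := GRing.PzSemiRing_isNonZero.Build Q Q1.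
by exists (HB.pack (GRing.ComPzRing.sort Q) Q m : comNzRingType).
Qed.

(** Modulo the ideal [I] that cuts out [Z] at [x], the point [x] falls into
    [Z]. So if [x] avoids [Z] over all nonzero rings, R/I is the zero ring. *)
Lemma complementP (X : zfunctor) (Z : zpred X) (R : comPzRingType) (x : X R)
    (I : R -> Prop) :
  (forall (S : comPzRingType) (f : {rmorphism R -> S}),
    Z S (act f x) <-> (forall r, I r -> f r = 0)) ->
  (forall (S : comNzRingType) (f : {rmorphism R -> S}), ~ Z _ (act f x)) <->
  ideal_span I 1.
Proof.
move=> IP; split=> [nZ|I1 S f /IP fI]; last first.
  have := ideal_span_ker fI I1; rewrite rmorph1 => /eqP.
  by rewrite oner_eq0.
have [Q [pi [_ piP]]] := ring_quotient I.
have [Q0|Q1] := eqVneq (1 : Q) 0; first by apply/piP; rewrite rmorph1.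
have [S SQ] := nonzero_comNzRing Q1; move: pi piP; rewrite -SQ => pi piP.
by case: (nZ S pi); apply/IP => r Ir; apply/piP/ideal_span_gen.
Qed.

(** Clear the denominators in an expression of 1 by elements of [I]. *)
Lemma ideal_span_localization (R S : comPzRingType) (f : {rmorphism R -> S})
    (a : R) (I : R -> Prop) : is_localization f a ->
  ideal_span (fun s => exists2 r, I r & s = f r) 1 ->
  exists N, ideal_span I (a ^+ N).
Proof.
move=> locP I1.
suff [N [r Ir e]] : exists N, exists2 r, ideal_span I r & f a ^+ N = f r.
  have [_ _ /(_ (a ^+ N - r))[]] := locP.
    by rewrite rmorphB rmorphXn e subrr.
  move=> M; rewrite mulrBr -exprD => /eqP; rewrite subr_eq0 => /eqP aM.
  by exists (M + N)%N; rewrite aM; exact: ideal_spanM.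
rewrite -[f a]mulr1.
suff H s : ideal_span (fun s => exists2 r, I r & s = f r) s ->
    exists N, exists2 r, ideal_span I r & f a ^+ N * s = f r.
  by have [N [r Ir e]] := H _ I1; exists N, r; rewrite // -e !mulr1.
move=> [n [c [b [cI <-]]]].
elim/big_ind: _ => [|x y [M [u Iu eu]] [N [v Iv ev]]|i _].
- by exists 0%N, 0; rewrite ?mulr0 ?rmorph0 //; exact: ideal_span0.
- exists (M + N)%N, (a ^+ N * u + a ^+ M * v).
    by apply: ideal_spanD; exact: ideal_spanM.
  rewrite mulrDr rmorphD !rmorphM !rmorphXn -eu -ev.
  by rewrite exprD -!mulrA [f a ^+ M * _]mulrCA.
have [r Ir ->] := cI i; have [_ /(_ (b i))[N [d ed]] _] := locP.
exists N, (d * r); last by rewrite mulrA ed rmorphM.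
exact/ideal_spanM/ideal_span_gen.
Qed.

Section Complement.
Variables (X : zfunctor) (Z : zpred X).
Hypothesis Zcl : closed_sub_in (@zfull X) Z.

(** Glue in [X]. By [complementP], the ideal [I] of [Z] at the glued point
    becomes the unit ideal in each localization, so it contains a power of each
    [a i], and these powers generate the unit ideal of R. *)
Lemma complement_sheaf : zariski_sheaf X -> zariski_sheaf (complement Z).
Proof.
move=> shX R n a S loc T l r unim locP lr TP x lx.
have [|y [yx yu]] :=
  shX R n a S loc T l r unim locP lr TP (fun i => sval (x i)).
  by move=> i j; have /(congr1 sval) := lx i j.
have [I IP] := @Zcl R y Logic.I.
suff I1 : ideal_span I 1.
  exists (exist _ y ((complementP IP).2 I1)); split=> [i|z zx].
    by apply: sval_inj; rewrite /= yx.
  by apply: sval_inj; apply: yu => i; rewrite -zx.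
have /choice[N NP] i : exists N, ideal_span I (a i ^+ N).
  apply: (ideal_span_localization (locP i)).
  apply/(complementP (Z := Z) (x := sval (x i))); last by case: (x i).
  move=> S' f; rewrite -yx act_comp IP; split=> [h _ [s Is ->]|h s Is].
    exact: h.
  by apply: h; exists s.
have [c <-] := unimodular_exp (\max_i N i) unim.
apply: ideal_span_sum => i; apply: ideal_spanM.
by rewrite -(subnK (leq_bigmax i)) exprD; exact: ideal_spanM.
Qed.

Lemma complement_separated : separated X -> separated (complement Z).
Proof.
move=> sepX R x y; have [I IP] := sepX R (sval x) (sval y); exists I => S f.
rewrite -IP; split=> [/(congr1 sval)//|e]; exact: sval_inj.
Qed.

End Complement.

(** * Affine spaces and their punctured versions *)

Lemma isomorphic_affine_recr n :
  isomorphic (affine n.+1) (zprod (affine n) (affine 1)).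
Proof.
rewrite -addn1; apply: isomorphic_sym.
apply: (@isomorphic_bij _ _ (affine_cat n 1)).
  exact: affine_cat_inj.
exact: affine_cat_surj.
Qed.

Lemma affine0_eq (R : comPzRingType) (x y : affine 0 R) : x = y.
Proof. by apply/rowP => -[]. Qed.

Lemma affine0_variety : is_variety (affine 0).
Proof.
split.
- move=> R n a S loc T l r unim locP lr TP x lx.
  by exists 0; split=> [i|z _]; exact: affine0_eq.
- apply: (@affine_cover_fin _ unit (fun=> affine 0) (fun=> zid _)) => [_|K x].
    split; first exact: affine_ft_affine.
    split=> [R x y //|R x]; exists (eq 1) => S f; split=> _; last first.
      by exists (act f x).
    by apply: ideal_span_gen; exists 1; rewrite ?rmorph1.
  by exists tt, x.
- by move=> R x y; exists (fun=> False) => S f; split=> // _; exact: affine0_eq.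
Qed.

Lemma affine_variety n : is_variety (affine n).
Proof.
elim: n => [|n IHn]; first exact: affine0_variety.
apply: variety_iso (isomorphic_sym (isomorphic_affine_recr n)) _.
exact: variety_prod IHn affine1_variety.
Qed.

Lemma origin_closed n :
  closed_sub_in (@zfull (affine n)) (fun R (v : 'rV[R]_n) => v = 0).
Proof.
move=> R v _; exists (fun r => exists i, r = (v : 'rV[R]_n) 0 i) => S f.
split=> [/rowP v0 _ [i ->]|v0]; first by have := v0 i; rewrite !mxE.
by apply/rowP => i; rewrite !mxE v0 //; exists i.
Qed.

Section Chart.
Variables (n : nat) (i : 'I_n).

(** The chart of the punctured A^n where the i-th coordinate is invertible. Its
    points carry the inverse [w], so that they are the solutions (v, w) of the
    equation v_i w = 1 in A^n x A^1. *)
Definition chart_pts (R : comPzRingType) :=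
  {p : zprod (affine n) (affine 1) R |
    (p.1 : 'rV[R]_n) 0 i * (p.2 : 'rV[R]_1) 0 0 = 1}.

Lemma chart_act_subproof (R S : comPzRingType) (f : {rmorphism R -> S})
    (p : chart_pts R) :
  ((act f (sval p)).1 : 'rV[S]_n) 0 i * ((act f (sval p)).2 : 'rV[S]_1) 0 0 = 1.
Proof. by case: p => p pu /=; rewrite !mxE -rmorphM pu rmorph1. Qed.

Definition chart_act (R S : comPzRingType) (f : {rmorphism R -> S}) p :
  chart_pts S := exist _ _ (@chart_act_subproof R S f p).

Lemma chart_actI (R : comPzRingType) (f : {rmorphism R -> R}) p :
  f =1 id -> chart_act f p = p.
Proof. by move=> fid; apply: sval_inj; apply: actI. Qed.

Lemma chart_actM (R S T : comPzRingType) (f : {rmorphism R -> S})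
    (g : {rmorphism S -> T}) (h : {rmorphism R -> T}) p :
  h =1 g \o f -> chart_act h p = chart_act g (chart_act f p).
Proof. by move=> hgf; apply: sval_inj; apply: actM. Qed.

Definition chart : zfunctor := ZFunctor chart_actI chart_actM.

Definition chart_graph : zmor chart (zprod (affine n) (affine 1)) :=
  @ZMor chart _ (fun R p => sval p) (fun _ _ _ _ => erefl).

Lemma chart_affine_ft : affine_ft chart.
Proof.
apply: (@closed_affine_ft _ _ (zcomp (affine_cat n 1) chart_graph)).
apply: closed_immersion_comp_iso.
- exact: affine_cat_inj.
- exact: affine_cat_surj.
split=> [R x y|R p _]; first exact: sval_inj.
exists (eq ((p.1 : 'rV[R]_n) 0 i * (p.2 : 'rV[R]_1) 0 0 - 1)) => S f.
split=> [[[q qu] /= qp] _ <-|/(_ _ erefl)].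
  by rewrite rmorphB rmorphM rmorph1 -[RHS](subrr 1) -[X in _ = X - _]qu qp !mxE.
rewrite rmorphB rmorphM rmorph1 => /eqP; rewrite subr_eq0 => /eqP fu.
have pu : ((act f p).1 : 'rV[S]_n) 0 i * ((act f p).2 : 'rV[S]_1) 0 0 = 1.
  by rewrite !mxE.
by exists (exist _ (act f p) pu).
Qed.

Lemma chart_punctured_subproof (R : comPzRingType) (p : chart R)
    (S : comNzRingType) (f : {rmorphism R -> S}) :
  act f (sval p).1 <> 0 :> 'rV[S]_n.
Proof.
case: p => [[v w] /= vw] /rowP/(_ i); rewrite !mxE => fv.
by have /eqP := rmorph1 f; rewrite -vw rmorphM fv mul0r eq_sym oner_eq0.
Qed.

Definition chart_incl : zmor chart (punctured_affine n).
Proof.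
exists (fun R p => exist _ _ (@chart_punctured_subproof R p)) => R S f x.
exact: sval_inj.
Defined.

Lemma chart_open : open_immersion chart_incl.
Proof.
split=> [R [[v w] vw] [[v' w'] vw'] /(congr1 sval) /= e|R [v vP]].
  rewrite -e in vw' *; apply: sval_inj => /=; congr pair.
  apply/rowP => j; rewrite ord1 -[LHS]mul1r -vw' /=.
  by rewrite mulrAC -[RHS]mul1r -vw.
exists (eq ((v : 'rV[R]_n) 0 i)) => S f.
rewrite -[generates_unit_ideal _]/(ideal_span _ 1).
have -> : (fun s => exists2 r, v 0 i = r & s = f r) = eq (f (v 0 i)).
  apply: funext => s; apply: propext.
  by split=> [[_ <- ->]|<-] //; exists (v 0 i).
rewrite ideal_span1P; split=> [[[[v' w] vw] /(congr1 sval) /= e]|[w vw]].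
  by exists (w 0 0); rewrite -vw /= e mxE.
have pu : ((act f v, const_mx w : affine 1 S).1 : 'rV[S]_n) 0 i *
    ((act f v, const_mx w : affine 1 S).2 : 'rV[S]_1) 0 0 = 1 by rewrite /= !mxE.
by exists (exist _ (act f v, const_mx w : affine 1 S) pu); exact: sval_inj.
Qed.

End Chart.

Lemma punctured_variety n : is_variety (punctured_affine n).
Proof.
have [sh _ sep] := affine_variety n; split.
- exact: complement_sheaf (@origin_closed n) sh.
- apply: (@affine_cover_fin _ 'I_n (@chart n) (@chart_incl n)) => [i|K [v vP]].
    split; [exact: chart_affine_ft | exact: chart_open].
  have /rV0Pn[i vi] : (v : 'rV[K]_n) != 0.
    apply/eqP => v0; apply: (vP K idfun); rewrite v0.
    by apply/rowP => j; rewrite !mxE.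
  have pu : ((v, const_mx (v 0 i)^-1 : affine 1 K).1 : 'rV[K]_n) 0 i *
      ((v, const_mx (v 0 i)^-1 : affine 1 K).2 : 'rV[K]_1) 0 0 = 1.
    by rewrite /= mxE mulfV.
  exists i, (exist _ (v, const_mx (v 0 i)^-1 : affine 1 K) pu).
  exact: sval_inj.
- exact: complement_separated.
Qed.

(** * Finite products *)

(** The factors are indexed by natural numbers so that the last one is [P n]
    for every length of the product. *)
Lemma isomorphic_prodn_recr n (P : nat -> zfunctor) :
  isomorphic (@zprodn n.+1 (fun i => P i))
    (zprod (@zprodn n (fun i => P i)) (P n)).
Proof.
pose F R (x : @zprodn n.+1 (fun i => P i) R) :
    zprod (@zprodn n (fun i => P i)) (P n) R :=
  (fun i => x (widen_ord (leqnSn n) i), x ord_max).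
have F_nat (R S : comPzRingType) (f : {rmorphism R -> S}) x :
  F S (act f x) = act f (F R x) by [].
apply: (@isomorphic_bij _ _ (ZMor F_nat)) => R.
  move=> x y [/= e emax]; apply: functional_extensionality_dep => i.
  have [lt|] := ltnP i n; last first.
    move=> ge; have -> // : i = ord_max.
    by apply/val_inj/eqP; rewrite eqn_leq ge -ltnS ltn_ord.
  have -> : i = widen_ord (leqnSn n) (Ordinal lt) by apply: val_inj.
  exact: (congr1 (fun z => z (Ordinal lt)) e).
move=> [x y].
have lt_or_eq (i : 'I_n.+1) : {is_true (i < n)%N} + {n = i :> nat}.
  have [lt|ge] := ltnP i n; [by left | right].
  by apply/eqP; rewrite eqn_leq ge -ltnS ltn_ord.
pose z (i : 'I_n.+1) : P i R := match lt_or_eq i with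
  | left lt => x (Ordinal lt)
  | right e => ecast k (P k R) e y
  end.
exists z; rewrite /= /F {}/z; congr pair.
  apply: functional_extensionality_dep => i; case: lt_or_eq => [lt|e].
    case: i lt => k kn /= lt.
    by have -> : lt = kn by exact: bool_irrelevance.
  by have := ltn_ord i; rewrite [X in (_ < X)%N]e ltnn.
case: lt_or_eq => [lt|e]; first by have := lt; rewrite ltnn.
by rewrite (eq_axiomK e).
Qed.

Lemma isomorphic_prodn0 (P : 'I_0 -> zfunctor) :
  isomorphic (zprodn P) (affine 0).
Proof.
pose F (R : comPzRingType) (x : zprodn P R) : affine 0 R := 0.
have F_nat (R S : comPzRingType) (f : {rmorphism R -> S}) x :
  F S (act f x) = act f (F R x) by exact: affine0_eq.
apply: (@isomorphic_bij _ _ (ZMor F_nat)) => R.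
  by move=> x y _; apply: functional_extensionality_dep => -[].
move=> x; have z (i : 'I_0) : P i R by case: i.
by exists z; exact: affine0_eq.
Qed.

Lemma variety_prodn n (P : nat -> zfunctor) :
  (forall i, is_variety (P i)) -> is_variety (@zprodn n (fun i => P i)).
Proof.
move=> PV; elim: n => [|n IHn].
  exact: variety_iso (isomorphic_sym (isomorphic_prodn0 _)) affine0_variety.
apply: variety_iso (isomorphic_sym (isomorphic_prodn_recr n P)) _.
exact: variety_prod.
Qed.

(** * Corner rings *)

Lemma idem_eq (R : comPzRingType) (e e' : idem R) : ival e = ival e' -> e = e'.
Proof.
by case: e e' => [e ee] [e' ee'] /= E; case: _ / E in ee' *; congr Idem.
Qed.

Lemma mul_idem_compl (R : comPzRingType) (e : idem R) :
  ival e * ival (idem_compl e) = 0.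
Proof. by rewrite mulrBr mulr1 idemP subrr. Qed.

Lemma to_cornerK (R : comPzRingType) (e : idem R) (x : corner e) :
  to_corner e (val x) = x.
Proof. by apply: val_inj; rewrite /= cornerE. Qed.

Lemma corner_map_to (R S : comPzRingType) (f : {rmorphism R -> S}) (e : idem R)
    (e' : idem S) (E : f (ival e) = ival e') (r : R) :
  corner_map E (to_corner e r) = to_corner e' (f r).
Proof. by apply: val_inj; rewrite /= rmorphM E. Qed.

Lemma act_corner (X : zfunctor) (R S : comPzRingType) (f : {rmorphism R -> S})
    (e : idem R) (e' : idem S) (E : f (ival e) = ival e') (x : X R) :
  act (corner_map E : {rmorphism _ -> _})
    (act (to_corner e : {rmorphism _ -> _}) x) =
  act (to_corner e' : {rmorphism _ -> _}) (act f x).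
Proof. rewrite !act_comp; apply: act_ext => r; exact: corner_map_to. Qed.

(** A map under which [e] becomes 1 factors through the localization eR. *)
Lemma corner_lift (R S : comPzRingType) (e : idem R) (f : {rmorphism R -> S}) :
  f (ival e) = 1 ->
  exists h : {rmorphism corner e -> S}, forall x, h x = f (val x).
Proof.
move=> fe; pose h (x : corner e) := f (val x).
have hB : zmod_morphism h by move=> x y; rewrite /h /= rmorphB.
have hM : monoid_morphism h by split=> [|x y]; rewrite /h /= ?rmorphM.
pose b := GRing.isZmodMorphism.Build _ _ h hB.
pose m := GRing.isMonoidMorphism.Build _ _ h hM.
by exists (HB.pack h b m : {rmorphism corner e -> S}).
Qed.

Lemma corner_lift_act (X : zfunctor) (R S : comPzRingType) (e : idem R)
    (f : {rmorphism R -> S}) (h : {rmorphism corner e -> S}) (x : X R) :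
  (forall s, h s = f (val s)) -> f (ival e) = 1 ->
  act h (act (to_corner e : {rmorphism _ -> _}) x) = act f x.
Proof.
move=> hE fe; rewrite act_comp; apply: act_ext => r /=.
by rewrite hE /= rmorphM fe mulr1.
Qed.

(** A Zariski cover of Spec R restricts to one of its clopen part Spec eR. *)
Lemma corner_localization (R S : comPzRingType) (f : {rmorphism R -> S}) (a : R)
    (e : idem R) (e' : idem S) (E : f (ival e) = ival e') :
  is_localization f a ->
  is_localization (corner_map E : {rmorphism _ -> _}) (to_corner e a).
Proof.
move=> [[u fu] surj ker]; split.
- exists (to_corner e' u).
  by rewrite [X in X * _](corner_map_to E) -rmorphM fu rmorph1.
- move=> s; have [n [r er]] := surj (val s); exists n, (to_corner e r).
  rewrite [X in X ^+ _](corner_map_to E) [RHS](corner_map_to E) -er.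
  rewrite -rmorphXn rmorphM; congr (_ * _); last exact/esym/to_cornerK.
  by rewrite !rmorphXn.
- move=> r /(congr1 val) /ker[n an0]; exists n.
  by rewrite -[r]to_cornerK -rmorphXn -rmorphM an0 rmorph0.
Qed.

(** The spectrum of the zero ring is covered by the empty family. *)
Lemma sheaf_zero (X : zfunctor) (R : comPzRingType) : zariski_sheaf X ->
  1 = 0 :> R -> (exists x : X R, True) /\ (forall x y : X R, x = y).
Proof.
move=> shX R0.
have [|i|i|i|i|x [_ xu]] := shX R 0%N (fun=> 0) (fun=> R) (fun=> idfun)
  (fun _ _ => R) (fun _ _ => idfun) (fun _ _ => idfun) _ _ _ _
  (fun i => False_rect _ (notF (ltn_ord i))).
- by exists (fun=> 0); rewrite big_ord0 R0.
- by case: i.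
- by case: i.
- by case: i.
- by case: i.
by split=> [|y z]; [exists x | rewrite -(xu y) -1?(xu z) // => -[]].
Qed.

(** * Clopen summands *)

(** The inclusion of an open and closed subfunctor: the locus of Spec R where a
    point [p] of [U] lies in [X] is the clopen part Spec eR. *)
Definition summand (X U : zfunctor) (inc : zmor X U) :=
  zinjective inc /\ forall (R : comPzRingType) (p : U R), exists e : idem R,
    image_of inc (act (to_corner e : {rmorphism _ -> _}) p) /\
    forall (S : comPzRingType) (f : {rmorphism R -> S}),
      image_of inc (act f p) -> f (ival e) = 1.

Section Summand.
Variables (X U : zfunctor) (inc : zmor X U).
Hypothesis incP : summand inc.

(** Let [p] lie in [X] over eR, and let [I] be an ideal of eR that describes
    the open set [V] there. Viewed in R, the elements of [I] are multiples of
    [e], so they can generate the unit ideal after a base change only if [e]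
    becomes 1. *)
Lemma open_sub_summand (V : zpred X) : open_sub V ->
  open_sub (fun R p => exists2 x : X R, V R x & inc R x = p).
Proof.
move=> Vop R p; have [inj /(_ R p)[e [[x ex] eP]]] := incP.
have [I IP] := Vop _ x; exists (fun r => exists2 s, I s & r = val s) => S f.
split=> [[u Vu eu]|span1].
  have fe : f (ival e) = 1 by apply: eP; exists u.
  have [h hE] := corner_lift fe.
  have hx : act h x = u.
    by apply: inj; rewrite mor_nat ex (corner_lift_act _ hE fe).
  have := (IP S h).1; rewrite hx => /(_ Vu); apply: ideal_span_sub => _ [s Is ->].
  by exists (val s); [exists s | rewrite hE].
have fe : f (ival e) = 1.
  (* Multiply an expression of 1 by multiples of [f e] with [f e]. *)
  have [n [a [b [aP ab1]]]] := span1; rewrite -[LHS]mul1r -ab1 mulr_suml.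
  apply: eq_bigr => i _; have [_ [s Is ->] ->] := aP i.
  by rewrite -mulrA -rmorphM cornerE.
have [h hE] := corner_lift fe.
exists (act h x); last by rewrite mor_nat ex (corner_lift_act _ hE fe).
apply/IP; apply: ideal_span_sub span1 => _ [_ [s Is ->] ->].
by exists s.
Qed.

Lemma open_immersion_summand (W : zfunctor) (f : zmor W X) :
  open_immersion f -> open_immersion (zcomp inc f).
Proof.
move=> [finj fop]; have [inj _] := incP.
split=> [R x y /= /inj/finj//|R p]; have [I IP] := open_sub_summand fop p.
exists I => S h; rewrite -IP; split=> [[w <-]|[x [w <-] <-]]; last by exists w.
by exists (f S w) => //; exists w.
Qed.

Lemma immersion_summand (W : zfunctor) (f : zmor W X) :
  immersion f -> immersion (zcomp inc f).
Proof.
move=> [finj [V [Vop fV fcl]]]; have [inj _] := incP.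
split=> [R x y /= /inj/finj//|].
exists (fun R p => exists2 x : X R, V R x & inc R x = p); split.
- exact: open_sub_summand.
- by move=> R _ [w <-]; exists (f R w) => //; apply: fV; exists w.
move=> R _ [x Vx <-]; have [I IP] := fcl R x Vx; exists I => S h.
rewrite -IP -mor_nat; split=> [[w /= /inj]|[w <-]]; first by exists w.
by exists w.
Qed.

Lemma closed_immersion_summand : closed_immersion inc.
Proof.
have [inj incE] := incP; split=> // R p _.
have [e [[x ex] eP]] := incE R p; exists (eq (1 - ival e)) => S f.
split=> [fp _ <-|/(_ _ erefl)/eqP]; first by rewrite rmorphB rmorph1 eP ?subrr.
rewrite rmorphB rmorph1 subr_eq0 eq_sym => /eqP fe.
have [h hE] := corner_lift fe; exists (act h x).
by rewrite mor_nat ex (corner_lift_act _ hE fe).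
Qed.

End Summand.

(** * The two inclusions into a disjoint union *)

Section Union.
Variables (X Y : zfunctor).
Local Notation U := (zunion X Y).

(** Stated on points of the functor instead of the record, so that [upt_act]
    can rewrite the idempotent of [act f p]. *)
Definition upt (R : comPzRingType) (p : U R) : idem R := @upart X Y R p.

Lemma upt_act (R S : comPzRingType) (f : {rmorphism R -> S}) (p : U R) :
  ival (upt (act f p)) = f (ival (upt p)).
Proof. by []. Qed.

Lemma union_eq_inv (R : comPzRingType) (p q : union_pts X Y R) : p = q ->
  (forall (E : idfun (ival (upart p)) = ival (upart q)) np nq,
    act (corner_map E : {rmorphism _ -> _}) (uleft (u := p) np) =
    uleft (u := q) nq) /\
  (forall (E : idfun (ival (idem_compl (upart p))) =
      ival (idem_compl (upart q))) np nq,
    act (corner_map E : {rmorphism _ -> _}) (uright (u := p) np) =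
    uright (u := q) nq).
Proof.
move=> <-; split=> E np nq; rewrite (bool_irrelevance np nq) actI // => z;
  exact: val_inj.
Qed.

(** The zero ring has no idempotent other than 0, over which nothing is
    recorded. *)
Lemma union_zero (R : comPzRingType) (p q : U R) : 1 = 0 :> R -> p = q.
Proof.
move=> R0; have R1 (x y : R) : x = y by rewrite -[x]mul1r -[y]mul1r R0 !mul0r.
by apply: (union_eq (E := R1 _ _) (E' := R1 _ _)) => np;
  case/eqP: (np); exact: R1.
Qed.

Definition idem0 (R : comPzRingType) : idem R := Idem (mul0r (0 : R)).

Lemma idem0_zero (R : comPzRingType) : ~ ival (idem0 R) != 0.
Proof. by rewrite eqxx. Qed.

Definition inr_fun (R : comPzRingType) (y : Y R) : union_pts X Y R :=
  @UnionPt X Y R (idem0 R) (fun ne => False_rect _ (idem0_zero ne))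
    (fun=> act (to_corner (idem_compl (idem0 R)) : {rmorphism _ -> _}) y).

Lemma inr_nat (R S : comPzRingType) (f : {rmorphism R -> S}) (y : Y R) :
  @inr_fun S (act f y) = @act U R S f (@inr_fun R y).
Proof.
have E : idfun (ival (upart (@inr_fun S (act f y)))) =
    ival (upart (@act U R S f (@inr_fun R y))) by rewrite /= rmorph0.
have E' : idfun (ival (idem_compl (upart (@inr_fun S (act f y))))) =
    ival (idem_compl (upart (@act U R S f (@inr_fun R y)))).
  by rewrite /= rmorph0.
apply: (union_eq (E := E) (E' := E')) => np nq; first by case: (idem0_zero np).
rewrite /= !act_comp; apply: act_ext => z; apply: val_inj.
by rewrite /= rmorphM rmorphB rmorph1 rmorph0.
Qed.

Definition zinr : zmor Y U := @ZMor Y U inr_fun inr_nat.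

(** Over the corner of its own idempotent, a point of the union is a point of
    the left summand. *)
Lemma inl_corner (R : comPzRingType) (p : U R) (ne : ival (upt p) != 0) :
  act (to_corner (upt p) : {rmorphism _ -> _}) p = zinl X Y _ (uleft (u := p) ne).
Proof.
set t := to_corner _; have tE : t (ival (upt p)) = 1.
  by apply: val_inj; rewrite /= idemP.
have E : idfun (ival (upt (act (t : {rmorphism _ -> _}) p))) =
    ival (upt (zinl X Y _ (uleft (u := p) ne))) := tE.
have E' : idfun (ival (idem_compl (upt (act (t : {rmorphism _ -> _}) p)))) =
    ival (idem_compl (upt (zinl X Y _ (uleft (u := p) ne)))).
  by rewrite /= -[_ (ival (upart p))]/(t _) tE.
apply: (union_eq (E := E) (E' := E')) => np nq; last by case: (idem1_compl nq).
rewrite /= (bool_irrelevance (idem_nz _ _) ne) !act_comp.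
by apply: act_ext => z; apply/val_inj/val_inj.
Qed.

Lemma inr_corner (R : comPzRingType) (p : U R)
    (ne : ival (idem_compl (upt p)) != 0) :
  act (to_corner (idem_compl (upt p)) : {rmorphism _ -> _}) p =
  zinr _ (uright (u := p) ne).
Proof.
set t := to_corner _; have tE : t (ival (upt p)) = 0.
  by apply: val_inj; rewrite /= mulrBr mulr1 idemP subrr.
have E : idfun (ival (upt (act (t : {rmorphism _ -> _}) p))) =
    ival (upt (zinr _ (uright (u := p) ne))) := tE.
have E' : idfun (ival (idem_compl (upt (act (t : {rmorphism _ -> _}) p)))) =
    ival (idem_compl (upt (zinr _ (uright (u := p) ne)))).
  by rewrite /= -[_ (ival (upart p))]/(t _) tE.
apply: (union_eq (E := E) (E' := E')) => np nq; first by case: (idem0_zero nq).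
rewrite /= (bool_irrelevance (idem_nz _ _) ne) !act_comp.
by apply: act_ext => z; apply/val_inj/val_inj; rewrite /= subr0.
Qed.

Hypotheses (shX : zariski_sheaf X) (shY : zariski_sheaf Y).

(** Over the zero ring the union has a single point, hence injectivity there
    rests on [X] having at most one. *)
Lemma zinl_inj : zinjective (zinl X Y).
Proof.
move=> R x x' /union_eq_inv[+ _].
have [R0|/eqP R1] := pselect (1 = 0 :> R); first by
  move=> _; exact: (sheaf_zero shX R0).2.
move=> /(_ erefl R1 R1) e.
have [h hE] := @corner_lift R R (idem1 R) idfun erefl.
have := congr1 (act h) e; rewrite act_comp !(corner_lift_act _ hE) //.
rewrite act_id => <-; rewrite -[LHS]act_id act_comp; apply: act_ext => r /=.
by rewrite hE /= mulr1.
Qed.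

Lemma zinr_inj : zinjective zinr.
Proof.
move=> R y y' /union_eq_inv[_ +].
have [R0|/eqP R1] := pselect (1 = 0 :> R); first by
  move=> _; exact: (sheaf_zero shY R0).2.
have R1' : ival (idem_compl (idem0 R)) != 0 by rewrite /= subr0.
move=> /(_ erefl R1' R1') e.
have fe : idfun (ival (idem_compl (idem0 R))) = 1 :> R by rewrite /= subr0.
have [h hE] := @corner_lift R R (idem_compl (idem0 R)) idfun fe.
have := congr1 (act h) e; rewrite act_comp !(corner_lift_act _ hE) //.
rewrite act_id => <-; rewrite -[LHS]act_id act_comp; apply: act_ext => r /=.
by rewrite hE /= subr0 mulr1.
Qed.

Lemma zinl_corner (R : comPzRingType) (p : U R) :
  image_of (zinl X Y) (act (to_corner (upt p) : {rmorphism _ -> _}) p).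
Proof.
have [e0|ne] := eqVneq (ival (upt p)) 0; last first.
  by exists (uleft (u := p) ne); rewrite inl_corner.
have z : 1 = 0 :> corner (upt p) by exact: val_inj.
have [[x _] _] := sheaf_zero shX z; exists x; exact: union_zero.
Qed.

Lemma zinr_corner (R : comPzRingType) (p : U R) :
  image_of zinr (act (to_corner (idem_compl (upt p)) : {rmorphism _ -> _}) p).
Proof.
have [e0|ne] := eqVneq (ival (idem_compl (upt p))) 0; last first.
  by exists (uright (u := p) ne); rewrite inr_corner.
have z : 1 = 0 :> corner (idem_compl (upt p)) by exact: val_inj.
have [[y _] _] := sheaf_zero shY z; exists y; exact: union_zero.
Qed.

Lemma zinl_summand : summand (zinl X Y).
Proof.
split=> [|R p]; first exact: zinl_inj.
exists (upt p); split=> [|S f [x /(congr1 (fun q => ival (upt q)))]].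
  exact: zinl_corner.
by rewrite upt_act.
Qed.

Lemma zinr_summand : summand zinr.
Proof.
split=> [|R p]; first exact: zinr_inj.
exists (idem_compl (upt p)); split=> [|S f [y /(congr1 (fun q => ival (upt q)))]].
  exact: zinr_corner.
by rewrite upt_act /= rmorphB rmorph1 => <-; rewrite subr0.
Qed.

Lemma zinl_image (R S : comPzRingType) (f : {rmorphism R -> S}) (p : U R) :
  f (ival (upt p)) = 1 -> image_of (zinl X Y) (act f p).
Proof.
move=> fe; have [h hE] := corner_lift fe; have [x xE] := zinl_corner p.
by exists (act h x); rewrite mor_nat xE (corner_lift_act _ hE fe).
Qed.

Lemma zinr_image (R S : comPzRingType) (f : {rmorphism R -> S}) (p : U R) :
  f (ival (upt p)) = 0 -> image_of zinr (act f p).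
Proof.
move=> fe; have fe' : f (ival (idem_compl (upt p))) = 1.
  by rewrite /= rmorphB rmorph1 [X in _ - X]fe subr0.
have [h hE] := corner_lift fe'; have [y yE] := zinr_corner p.
by exists (act h y); rewrite mor_nat yE (corner_lift_act _ hE fe').
Qed.

(** Spec R is the disjoint union of Spec eR and Spec (1 - e)R, and over each of
    these parts [p] and [q] are points of a single summand. *)
Lemma union_corner_eq (R : comPzRingType) (p q : U R) (e d : idem R) :
  ival (upt p) = ival e -> ival (upt q) = ival e -> ival d = 1 - ival e ->
  act (to_corner e : {rmorphism _ -> _}) p =
    act (to_corner e : {rmorphism _ -> _}) q ->
  act (to_corner d : {rmorphism _ -> _}) p =
    act (to_corner d : {rmorphism _ -> _}) q ->
  p = q.
Proof.
move=> /idem_eq pe /idem_eq qe de; have -> : d = idem_compl e by exact: idem_eq.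
case: q qe => [c' x' y']; rewrite /upt /= => qe; subst c'.
case: p pe => [c x y]; rewrite /upt /= => pe; subst c.
set p := UnionPt x y; set q := UnionPt x' y' => eL eR.
have ex : x = x'.
  apply: functional_extensionality_dep => ne; apply: zinl_inj.
  by rewrite -(inl_corner (p := p) ne) -(inl_corner (p := q) ne).
have ey : y = y'.
  apply: functional_extensionality_dep => ne; apply: zinr_inj.
  by rewrite -(inr_corner (p := p) ne) -(inr_corner (p := q) ne).
by rewrite /p /q ex ey.
Qed.

Lemma union_pt (R : comPzRingType) (e : idem R) (x : X (corner e))
    (y : Y (corner (idem_compl e))) : exists p : U R,
  [/\ upt p = e,
    act (to_corner e : {rmorphism _ -> _}) p = zinl X Y _ x &
    act (to_corner (idem_compl e) : {rmorphism _ -> _}) p = zinr _ y].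
Proof.
pose p : U R := @UnionPt X Y R e (fun=> x) (fun=> y); exists p; split=> //.
  have [e0|ne] := eqVneq (ival (upt p)) 0; last exact: (inl_corner (p := p) ne).
  by apply: union_zero; exact: val_inj.
have [e0|ne] := eqVneq (ival (idem_compl (upt p))) 0; last first.
  exact: (inr_corner (p := p) ne).
by apply: union_zero; exact: val_inj.
Qed.

End Union.

(** Local points of [U] that lie in [X] over the corners of [e_ i] are glued in
    [X], along the cover of Spec eR by the spectra of these corners. *)
Lemma sheaf_corner_glue (X U : zfunctor) (inc : zmor X U) (R : comPzRingType)
    (n : nat) (a : 'I_n -> R) (S : 'I_n -> comPzRingType)
    (loc : forall i, {rmorphism R -> S i}) (T : 'I_n -> 'I_n -> comPzRingType)
    (l : forall i j, {rmorphism S i -> T i j})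
    (r : forall i j, {rmorphism S j -> T i j}) (p : forall i, U (S i))
    (e : idem R) (e_ : forall i, idem (S i))
    (E : forall i, loc i (ival e) = ival (e_ i)) :
  zariski_sheaf X -> zinjective inc ->
  (exists b : 'I_n -> R, \sum_(i < n) b i * a i = 1) ->
  (forall i, is_localization (loc i) (a i)) ->
  (forall i j, l i j \o loc i =1 r i j \o loc j) ->
  (forall i j,
    is_localization (l i j \o loc i : {rmorphism R -> T i j}) (a i * a j)) ->
  (forall i j, act (l i j) (p i) = act (r i j) (p j)) ->
  (forall i, image_of inc (act (to_corner (e_ i) : {rmorphism _ -> _}) (p i))) ->
  exists! x : X (corner e), forall i,
    act (corner_map (E i) : {rmorphism _ -> _}) (inc _ x) =
    act (to_corner (e_ i) : {rmorphism _ -> _}) (p i).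
Proof.
move=> shX inj unim locP lr TP lp pE; pose x i := sval (cid (pE i)).
have xE i : inc _ (x i) = act (to_corner (e_ i) : {rmorphism _ -> _}) (p i).
  exact: svalP (cid (pE i)).
pose t i j := idem_map (l i j) (e_ i).
have tl i j : l i j (ival (e_ i)) = ival (t i j) by [].
have tr i j : r i j (ival (e_ j)) = ival (t i j).
  by rewrite -tl -!E; exact/esym/lr.
have [|i|i j s|i j|i j|y [yx yu]] := shX (corner e) n (fun i => to_corner e (a i))
  (fun i => corner (e_ i)) (fun i => corner_map (E i))
  (fun i j => corner (t i j)) (fun i j => corner_map (tl i j))
  (fun i j => corner_map (tr i j)) _ _ _ _ x.
- have [b b1] := unim; exists (fun i => to_corner e (b i)).
  have := congr1 (to_corner e) b1; rewrite rmorph_sum rmorph1 => <-.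
  by apply: eq_bigr => i _; rewrite rmorphM.
- exact: corner_localization.
- by apply: val_inj; exact: lr.
- have te : (l i j \o loc i) (ival e) = ival (t i j) by rewrite /= E.
  have := corner_localization te (TP i j); rewrite rmorphM.
  congr is_localization; apply: rmorphism_ext => z; exact: val_inj.
- by apply: inj; rewrite !mor_nat !xE !act_corner lp.
exists y; split=> [i|y' yE]; first by rewrite -mor_nat yx xE.
by apply: yu => i; apply: inj; rewrite mor_nat yE xE.
Qed.

(** * Disjoint unions of varieties *)

Section UnionVariety.
Variables (X Y : zfunctor).
Local Notation U := (zunion X Y).

(** The idempotents of the local points are glued first, to an idempotent [e]
    of R; then [sheaf_corner_glue] applies to [X] over eR and to [Y] over (1 -
    e)R. *)
Lemma union_sheaf : zariski_sheaf X -> zariski_sheaf Y -> zariski_sheaf U.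
Proof.
move=> shX shY R n a S loc T l r unim locP lr TP p lp.
have [|c [cE cu]] := ring_sheaf unim locP lr TP (x := fun i => ival (upt (p i))).
  by move=> i j; rewrite -!upt_act lp.
have cc : c * c = c.
  by apply/esym/cu => i; rewrite rmorphM cE idemP.
pose e := Idem cc.
have eE i : loc i (ival e) = ival (upt (p i)) by exact: cE.
have eE' i : loc i (ival (idem_compl e)) = ival (idem_compl (upt (p i))).
  by rewrite /= rmorphB rmorph1 cE.
have [x [xE xu]] := sheaf_corner_glue eE shX (zinl_inj shX) unim locP lr TP lp
  (fun i => zinl_corner shX (p i)).
have [y [yE yu]] := sheaf_corner_glue eE' shY (zinr_inj shY) unim locP lr TP lp
  (fun i => zinr_corner shY (p i)).
have [q [qe qx qy]] := union_pt x y.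
exists q; split=> [i|z zE].
  apply: (union_corner_eq shX shY (e := upt (p i))
    (d := idem_compl (upt (p i)))) => //.
  - by rewrite upt_act qe; exact: cE.
  - by rewrite -(act_corner (eE i)) qx xE.
  - by rewrite -(act_corner (eE' i)) qy yE.
have ze : upt z = e.
  by apply: idem_eq; apply/esym/cu => i; rewrite -upt_act zE.
have [x' x'E] := zinl_corner shX z; have [y' y'E] := zinr_corner shY z.
rewrite ze in x' x'E y' y'E.
apply: (union_corner_eq shX shY (e := e) (d := idem_compl e)); rewrite ?qe ?ze //.
  rewrite qx -x'E; congr (zinl _ _ _ _); apply: xu => i.
  by rewrite x'E act_corner zE.
rewrite qy -y'E; congr (zinr _ _ _ _); apply: yu => i.
by rewrite y'E act_corner zE.
Qed.

Lemma union_field (K : fieldType) (p : U K) :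
  zariski_sheaf X -> zariski_sheaf Y ->
  image_of (zinl X Y) p \/ image_of (zinr X Y) p.
Proof.
move=> shX shY; have := idemP (upt p); move=> /eqP.
rewrite -subr_eq0 -[X in _ - X]mulr1 -mulrBr mulf_eq0 subr_eq0.
case/orP=> /eqP pe; [right|left]; rewrite -[p]act_id.
  exact: zinr_image.
exact: zinl_image.
Qed.

Lemma zinl_zinr (R : comPzRingType) (x : X R) (y : Y R) :
  zinl X Y R x = zinr X Y R y -> 1 = 0 :> R.
Proof. by move=> /(congr1 (fun p => ival (upt p))). Qed.

(** Two points agree where their idempotents agree, their parts in [X] agree
    over the locus [g] where both lie in [X], and their parts in [Y] agree over
    the locus [h] where both lie in [Y]. *)
Lemma union_separated : is_variety X -> is_variety Y -> separated U.
Proof.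
move=> [shX _ sepX] [shY _ sepY] R p q.
have gP (e e' : idem R) :
    (ival e * ival e') * (ival e * ival e') = ival e * ival e'.
  by rewrite mulrACA !idemP.
pose g := Idem (gP (upt p) (upt q)).
pose h := Idem (gP (idem_compl (upt p)) (idem_compl (upt q))).
have [x xE] : image_of (zinl X Y) (act (to_corner g : {rmorphism _ -> _}) p).
  by apply: zinl_image => //; apply: val_inj; rewrite /= mulrA idemP.
have [x' x'E] : image_of (zinl X Y) (act (to_corner g : {rmorphism _ -> _}) q).
  by apply: zinl_image => //; apply: val_inj; rewrite /= mulrCA idemP.
have [y yE] : image_of (zinr X Y) (act (to_corner h : {rmorphism _ -> _}) p).
  apply: zinr_image => //; apply: val_inj; rewrite /= mulrA.
  by rewrite [X in X * _](mul_idem_compl (upt p)) mul0r.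
have [y' y'E] : image_of (zinr X Y) (act (to_corner h : {rmorphism _ -> _}) q).
  apply: zinr_image => //; apply: val_inj; rewrite /= mulrCA.
  by rewrite [X in _ * X](mul_idem_compl (upt q)) mulr0.
have [I IP] := sepX _ x x'; have [J JP] := sepY _ y y'.
exists (fun r => [\/ r = ival (upt p) - ival (upt q),
  exists2 s, I s & r = val s | exists2 s, J s & r = val s]) => S f.
pose kg := corner_map (idem_mapE f g); pose kh := corner_map (idem_mapE f h).
have xx' : act (to_corner (idem_map f g) : {rmorphism _ -> _}) (act f p) =
    act (to_corner (idem_map f g) : {rmorphism _ -> _}) (act f q) <->
    act (kg : {rmorphism _ -> _}) x = act (kg : {rmorphism _ -> _}) x'.
  rewrite -!(act_corner (idem_mapE f g)) -xE -x'E -!mor_nat.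
  by split=> [/(zinl_inj shX)|->].
have yy' : act (to_corner (idem_map f h) : {rmorphism _ -> _}) (act f p) =
    act (to_corner (idem_map f h) : {rmorphism _ -> _}) (act f q) <->
    act (kh : {rmorphism _ -> _}) y = act (kh : {rmorphism _ -> _}) y'.
  rewrite -!(act_corner (idem_mapE f h)) -yE -y'E -!mor_nat.
  by split=> [/(zinr_inj shY)|->].
split=> [pq r|fr].
  case=> [->|[s Is ->]|[s Js ->]].
  - by rewrite rmorphB -!upt_act pq subrr.
  - have /IP/(_ s Is)/(congr1 val) // : act (kg : {rmorphism _ -> _}) x =
      act (kg : {rmorphism _ -> _}) x' by apply/xx'; rewrite pq.
  - have /JP/(_ s Js)/(congr1 val) // : act (kh : {rmorphism _ -> _}) y =
      act (kh : {rmorphism _ -> _}) y' by apply/yy'; rewrite pq.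
have fpq : f (ival (upt p)) = f (ival (upt q)).
  by apply/eqP; rewrite -subr_eq0 -rmorphB fr //; constructor 1.
apply: (union_corner_eq shX shY (e := idem_map f g) (d := idem_map f h)).
- by rewrite upt_act /= rmorphM -fpq -rmorphM idemP.
- by rewrite upt_act /= rmorphM fpq -rmorphM idemP.
- rewrite /= !rmorphM !rmorphB rmorph1 -fpq -!rmorphM idemP.
  by rewrite mulrBl mul1r mulrBr mulr1 -rmorphM idemP subrr subr0.
- by apply/xx'/IP => s Is; apply: val_inj; apply: fr; constructor 2; exists s.
- by apply/yy'/JP => s Js; apply: val_inj; apply: fr; constructor 3; exists s.
Qed.

Lemma variety_union : is_variety X -> is_variety Y -> is_variety U.
Proof.
move=> Xv Yv; have [shX [m [A [f [fP covf]]]] _] := Xv.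
have [shY [n [B [g [gP covg]]]] _] := Yv; split.
- exact: union_sheaf.
- pose Z (k : 'I_m + 'I_n) :=
    match k with inl i => zspec (A i) | inr j => zspec (B j) end.
  pose h k : zmor (Z k) U := match k with
    | inl i => zcomp (zinl X Y) (f i) | inr j => zcomp (zinr X Y) (g j) end.
  apply: (@affine_cover_fin _ _ Z h) => [[i|j]|K p].
  + have [Afg fop] := fP i; split; last first.
      exact: (open_immersion_summand (zinl_summand Y shX) fop).
    by exists (A i); split=> //; exact: isomorphic_refl.
  + have [Bfg gop] := gP j; split; last first.
      exact: (open_immersion_summand (zinr_summand X shY) gop).
    by exists (B j); split=> //; exact: isomorphic_refl.
  have [[x <-]|[y <-]] := union_field p shX shY.
    by have [i [a <-]] := covf K x; exists (inl i), a.
  by have [j [b <-]] := covg K y; exists (inr j), b.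
- exact: union_separated.
Qed.

(** If the idempotent [e] of a point is nonzero, the point lies in [X] over the
    nonzero ring eR. So a point of the complement has e = 0. *)
Lemma complement_zinl : zariski_sheaf X -> zariski_sheaf Y ->
  isomorphic Y (complement (image_of (zinl X Y))).
Proof.
move=> shX shY.
have inrC (R : comPzRingType) (y : Y R) (S : comNzRingType)
    (f : {rmorphism R -> S}) :
    ~ image_of (zinl X Y) (act f (zinr X Y R y)).
  move=> [x]; rewrite -mor_nat => /zinl_zinr/eqP; by rewrite oner_eq0.
pose F R y : complement (image_of (zinl X Y)) R := exist _ _ (@inrC R y).
have F_nat (R S : comPzRingType) (f : {rmorphism R -> S}) (y : Y R) :
    F S (act f y) = act f (F R y).
  by apply: sval_inj; exact: (mor_nat (zinr X Y)).
apply: (@isomorphic_bij _ _ (ZMor F_nat)) => R.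
  by move=> y y' /(congr1 sval)/(zinr_inj shY).
move=> [p pC]; have [y yp] : image_of (zinr X Y) p.
  rewrite -[p]act_id; apply: zinr_image => //=.
  apply/eqP/negP => /negP ne.
  have ne1 : 1 != 0 :> corner (upt p) by rewrite -(inj_eq val_inj).
  have pC' (Q : comPzRingType) (f : {rmorphism R -> Q}) : 1 != 0 :> Q ->
      ~ image_of (zinl X Y) (act f p).
    by move=> /nonzero_comNzRing[S SQ]; move: f; rewrite -SQ; exact: pC.
  exact: pC' ne1 (zinl_corner shX p).
by exists y; exact: sval_inj.
Qed.

End UnionVariety.

Section UnionMap.
Variables (X X' Y Y' : zfunctor) (f : zmor X X') (g : zmor Y Y').

Definition union_map_fun (R : comPzRingType) (p : zunion X Y R) :
    zunion X' Y' R :=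
  @UnionPt X' Y' R (upt p) (fun ne => f _ (uleft (u := p) ne))
    (fun ne => g _ (uright (u := p) ne)).

Lemma union_map_nat (R S : comPzRingType) (h : {rmorphism R -> S})
    (p : zunion X Y R) :
  union_map_fun (act h p) = act h (union_map_fun p).
Proof.
by congr UnionPt; apply: functional_extensionality_dep => ne /=; rewrite mor_nat.
Qed.

Definition union_map := ZMor union_map_nat.

End UnionMap.

Lemma union_mapK (X X' Y Y' : zfunctor) (f : zmor X X') (f' : zmor X' X)
    (g : zmor Y Y') (g' : zmor Y' Y) :
  (forall R, cancel (f R) (f' R)) -> (forall R, cancel (g R) (g' R)) ->
  forall R, cancel (union_map f g R) (union_map f' g' R).
Proof.
move=> fK gK R [e x y]; congr UnionPt;
  by apply: functional_extensionality_dep => ne /=; rewrite ?fK ?gK.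
Qed.

Lemma isomorphic_union (X X' Y Y' : zfunctor) :
  isomorphic X X' -> isomorphic Y Y' -> isomorphic (zunion X Y) (zunion X' Y').
Proof.
move=> [f [f' ff]] [g [g' gg]]; exists (union_map f g), (union_map f' g') => R.
by split; apply: union_mapK => S; have [] := (ff S, gg S); case=> ? ? [].
Qed.

Lemma isomorphic_empty_union (X : zfunctor) : zariski_sheaf X ->
  isomorphic X (zunion zempty X).
Proof.
move=> shX; apply: (@isomorphic_bij _ _ (zinr zempty X)) => R.
  exact: zinr_inj.
move=> p; rewrite -[p]act_id; apply: zinr_image => //=.
by apply/eqP/negP => /negP ne; have /(congr1 val) := uleft (u := p) ne; apply/eqP.
Qed.

(** * Motivic invariants *)

(** What point counts and classes in the Grothendieck ring have in common: they
    are multiplicative, and determined on a scheme by a closed subscheme and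
    its complement, or on the complement by the other two. *)
Record motivic (M : zfunctor -> {poly int} -> Prop) := Motivic {
  motivic_iso : forall X Y P, isomorphic X Y -> M X P -> M Y P;
  motivic_point : M (affine 0) 1;
  motivic_line : M (affine 1) 'X;
  motivic_prod : forall X Y P Q, M X P -> M Y Q -> M (zprod X Y) (P * Q);
  motivic_add : forall X Z U (i : zmor Z X) P Q, is_variety X ->
    closed_immersion i -> isomorphic U (complement (image_of i)) ->
    M Z P -> M U Q -> M X (P + Q);
  motivic_sub : forall X Z U (i : zmor Z X) P Q, is_variety U ->
    closed_immersion i -> isomorphic U (complement (image_of i)) ->
    M X P -> M Z Q -> M U (P - Q) }.

Section Motivic.
Variables (M : zfunctor -> {poly int} -> Prop) (MP : motivic M).

Lemma motivic_affine n : M (affine n) ('X ^+ n).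
Proof.
elim: n => [|n IHn]; first exact: motivic_point.
apply: (motivic_iso MP (isomorphic_sym (isomorphic_affine_recr n))).
by rewrite exprSr; apply: motivic_prod => //; exact: motivic_line.
Qed.

Definition origin n : zmor (affine 0) (affine n).
Proof.
exists (fun (R : comPzRingType) _ => 0 : 'rV[R]_n) => R S f x.
by apply/rowP => i; rewrite !mxE rmorph0.
Defined.

Lemma origin_image n :
  image_of (origin n) =
    (fun (R : comPzRingType) (v : 'rV[R]_n) => v = 0) :> zpred (affine n).
Proof.
apply: functional_extensionality_dep => R.
apply: functional_extensionality_dep => v.
by apply: propext; split=> [[_ <-]|->] //; exists (0 : 'rV_0).
Qed.

Lemma motivic_punctured n : M (punctured_affine n) ('X ^+ n - 1).
Proof.
apply: (motivic_sub MP (i := origin n)).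
- exact: punctured_variety.
- split=> [R x y _|]; first exact: affine0_eq.
  by rewrite origin_image; exact: origin_closed.
- by rewrite origin_image; exact: isomorphic_refl.
- exact: motivic_affine.
- exact: motivic_point.
Qed.

Lemma motivic_flag m : M (punctured_flag m) (qfact m).
Proof.
rewrite /qfact; elim: m => [|m IHm].
  rewrite big_ord0.
  apply: (motivic_iso MP (isomorphic_sym (isomorphic_prodn0 _))).
  exact: motivic_point.
apply: (motivic_iso MP (isomorphic_sym
  (isomorphic_prodn_recr m (fun i => punctured_affine i.+1)))).
rewrite big_ord_recr; apply: motivic_prod => //; exact: motivic_punctured.
Qed.

Lemma motivic_union X Y P Q : is_variety X -> is_variety Y ->
  M X P -> M Y Q -> M (zunion X Y) (P + Q).
Proof.
move=> Xv Yv; have [shX _ _] := Xv; have [shY _ _] := Yv.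
apply: (motivic_add MP (i := zinl X Y)).
- exact: variety_union.
- exact: closed_immersion_summand (zinl_summand _ shX).
- exact: complement_zinl.
Qed.

End Motivic.

Lemma flag_variety m : is_variety (punctured_flag m).
Proof.
apply: (@variety_prodn m (fun i => punctured_affine i.+1)) => i.
exact: punctured_variety.
Qed.

Lemma X_sigma_variety N : is_variety (X_sigma N).
Proof.
elim: N => [|N IHN]; first exact: affine_variety.
apply: variety_union => //; apply: variety_prod; first exact: affine_variety.
exact: flag_variety.
Qed.

Lemma N_sigmaS n : N_sigma n.+1 = N_sigma n + 'X ^+ n.+1 * qfact n.
Proof. by rewrite /N_sigma big_ord_recr addrA. Qed.

Lemma motivic_sigma M N : motivic M -> M (X_sigma N) (N_sigma N).
Proof.
move=> MP; elim: N => [|N IHN].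
  by rewrite /N_sigma big_ord0 addr0; exact: motivic_point.
rewrite N_sigmaS; apply: motivic_union => //.
- exact: X_sigma_variety.
- by apply: variety_prod; [exact: affine_variety | exact: flag_variety].
- by apply: motivic_prod => //; [exact: motivic_affine | exact: motivic_flag].
Qed.

(** * Counting points *)

Definition card_is (T : Type) (c : nat) := exists h : 'I_c -> T, bijective h.

Lemma card_is_fin (J : finType) (T : Type) (h : J -> T) :
  bijective h -> card_is T #|J|.
Proof.
move=> hbij; exists (h \o enum_val); apply: bij_comp => //; exact: enum_val_bij.
Qed.

Lemma card_is_bij (A B : Type) (f : A -> B) c :
  bijective f -> card_is A c -> card_is B c.
Proof. by move=> fb [h hb]; exists (f \o h); exact: bij_comp. Qed.

Lemma card_is_uniq (T : Type) c d : card_is T c -> card_is T d -> c = d.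
Proof.
move=> [h hb] [k [k' kK k'K]]; rewrite -[LHS]card_ord -[RHS]card_ord.
apply: (@bij_eq_card _ _ (k' \o h)); apply: bij_comp => //.
by exists k.
Qed.

Lemma card_is_sum (A B : Type) a b :
  card_is A a -> card_is B b -> card_is (A + B) (a + b).
Proof.
move=> [f [f' fK f'K]] [g [g' gK g'K]].
rewrite -[a]card_ord -[b]card_ord -card_sum.
apply: (@card_is_fin ('I_a + 'I_b)%type _
  (fun u => match u with inl i => inl (f i) | inr j => inr (g j) end)).
exists (fun u => match u with inl i => inl (f' i) | inr j => inr (g' j) end);
  by case=> u; rewrite ?fK ?gK ?f'K ?g'K.
Qed.

Lemma card_is_prod (A B : Type) a b :
  card_is A a -> card_is B b -> card_is (A * B) (a * b).
Proof.
move=> [f [f' fK f'K]] [g [g' gK g'K]].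
rewrite -[a]card_ord -[b]card_ord -card_prod.
apply: (@card_is_fin ('I_a * 'I_b)%type _ (fun u => (f u.1, g u.2))).
by exists (fun u => (f' u.1, g' u.2)) => -[u v] /=; rewrite ?fK ?gK ?f'K ?g'K.
Qed.

Lemma card_is_diff (A B : Type) c a :
  card_is (A + B) c -> card_is A a -> exists2 b, card_is B b & c = (a + b)%N.
Proof.
move=> cC aA; have [h [h' hK h'K]] := cC.
pose J : finType := {k : 'I_c | `[< exists b, h' (inr b) = k >]}.
have JB (k : J) : exists b, h' (inr b) = val k by case: k => k /= /asboolP.
pose g k := sval (cid (JB k)); have gE k : h' (inr (g k)) = val k.
  exact: svalP (cid (JB k)).
have Bb : card_is B #|J|.
  apply: (@card_is_fin J _ g); apply: bij_inj_surj.
    by move=> k l e; apply: val_inj; rewrite -!gE e.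
  move=> b; have bJ : `[< exists b', h' (inr b') = h' (inr b) >].
    by apply/asboolP; exists b.
  exists (Sub (h' (inr b)) bJ : J); have := gE (Sub (h' (inr b)) bJ : J).
  by move=> /(can_inj h'K) [].
exists #|J| => //; exact: card_is_uniq cC (card_is_sum aA Bb).
Qed.

(** Nonzero rings over a field [K] contain it, so a [K]-point that falls into
    [Z] after a base change to a nonzero ring lies on [Z] already. *)
Lemma field_scissors (X Z U : zfunctor) (i : zmor Z X) (K : fieldType) :
  closed_immersion i -> isomorphic U (complement (image_of i)) ->
  exists f : Z K + U K -> X K, bijective f.
Proof.
move=> [iinj icl] /isomorphicP[j [jinj jsurj]].
exists (fun u => match u with inl z => i K z | inr u => sval (j K u) end).
have disj (z : Z K) u : i K z <> sval (j K u).
  move=> e; apply: (svalP (j K u) K idfun).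
  by rewrite act_id; exists z.
apply: bij_inj_surj => [[z|u] [z'|u'] e|x].
- by congr inl; exact: iinj.
- by case: (disj z u').
- by case: (disj z' u).
- by congr inr; apply/jinj/sval_inj.
have [[z zx]|nx] := pselect (image_of i x); first by exists (inl z).
have xC (S : comNzRingType) (f : {rmorphism K -> S}) : ~ image_of i (act f x).
  move=> fx; apply: nx; have [I IP] := icl K x Logic.I.
  rewrite -[x]act_id; apply/IP => r /((IP S f).1 fx r)/eqP.
  by rewrite fmorph_eq0 => /eqP.
by have [u ux] := jsurj K (exist _ x xC); exists (inr u); rewrite ux.
Qed.

Lemma counting_motivic : motivic counting_polynomial.
Proof.
have countP X P : counting_polynomial X P <->
    forall F : finFieldType, exists2 c, card_is (X F) c & c%:Z = P.[#|F|%:Z].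
  split=> XP F; have [c] := XP F.
    by case=> h [hb e]; exists c => //; exists h.
  by case=> h hb e; exists c, h.
split=> [X Y P /isomorphicP[f [finj fsurj]]|||X Y P Q
  |X Z U i P Q _ icl iU|X Z U i P Q _ icl iU];
  rewrite !countP.
- move=> XP F; have [c cX e] := XP F; exists c => //.
  by apply: card_is_bij cX; apply: bij_inj_surj; [exact: finj | exact: fsurj].
- move=> F; exists #|'rV[F]_0|; last by rewrite card_mx muln0 hornerC.
  by apply: (@card_is_fin _ _ id); exists id.
- move=> F; exists #|'rV[F]_1|; last by rewrite card_mx hornerX.
  by apply: (@card_is_fin _ _ id); exists id.
- move=> XP YQ F; have [c cX ec] := XP F; have [d dY ed] := YQ F.
  by exists (c * d)%N; [exact: card_is_prod | rewrite PoszM hornerM ec ed].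
- move=> ZP UQ F; have [c cZ ec] := ZP F; have [d dU ed] := UQ F.
  have [f fb] := field_scissors F icl iU.
  exists (c + d)%N; last by rewrite PoszD hornerD ec ed.
  exact: card_is_bij fb (card_is_sum cZ dU).
- move=> XP ZQ F; have [c cX ec] := XP F; have [d dZ ed] := ZQ F.
  have [f [g fK gK]] := field_scissors F icl iU.
  have /card_is_diff/(_ dZ)[b bU cb] : card_is (Z F + U F) c.
    by apply: card_is_bij cX; exists f.
  exists b => //; rewrite hornerD hornerN -ec -ed cb PoszD.
  by rewrite addrC addKr.
Qed.

(** * The Grothendieck ring *)

#[local] Instance K0_equivalence : Equivalence K0_eq.
Proof. split; [exact: K0_refl | exact: K0_sym | exact: K0_trans]. Qed.

#[local] Instance K0_add_proper : Proper (K0_eq ==> K0_eq ==> K0_eq) K0_add.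
Proof. by move=> a b ab c d cd; exact: K0_addE. Qed.

#[local] Instance K0_mul_proper : Proper (K0_eq ==> K0_eq ==> K0_eq) K0_mul.
Proof. by move=> a b ab c d cd; exact: K0_mulE. Qed.

#[local] Instance K0_opp_proper : Proper (K0_eq ==> K0_eq) K0_opp.
Proof. by move=> a b ab; exact: K0_oppE. Qed.

(** Subtraction is named because ring normalization asks for it. *)
Definition K0_sub a b := K0_add a (K0_opp b).

#[local] Instance K0_sub_proper : Proper (K0_eq ==> K0_eq ==> K0_eq) K0_sub.
Proof. by move=> a b ab c d cd; apply/K0_addE/K0_oppE. Qed.

Lemma K0_ring_theory :
  ring_theory K0_zero K0_one K0_add K0_mul K0_sub K0_opp K0_eq.
Proof.
split; try by constructor.
by move=> a; apply: K0_trans (K0_addC _ _) (K0_addN _).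
Qed.

Lemma K0_ring_ext : ring_eq_ext K0_add K0_mul K0_opp K0_eq.
Proof.
split; [exact: K0_add_proper | exact: K0_mul_proper | exact: K0_opp_proper].
Qed.

Add Ring K0_ring : K0_ring_theory (setoid K0_equivalence K0_ring_ext).

Lemma K0_int_succ (n : int) : K0_eq (K0_int (n + 1)) (K0_add K0_one (K0_int n)).
Proof.
case: n => [m|[|m]].
- by rewrite -PoszD addn1; reflexivity.
- by rewrite /=; ring.
- have -> : Negz m.+1 + 1 = Negz m by rewrite !NegzE -addn1 PoszD opprD addrNK.
  by rewrite /=; ring.
Qed.

Lemma K0_int_pred (n : int) :
  K0_eq (K0_int (n - 1)) (K0_sub (K0_int n) K0_one).
Proof.
have := K0_int_succ (n - 1); rewrite subrK /K0_sub => ->; ring.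
Qed.

(** Induction by steps of 1 in both directions, which matches [K0_int_succ] and
    [K0_int_pred] and leaves the constructors of int aside. *)
Lemma int_step_ind (P : int -> Prop) :
  P 0 -> (forall k, P k -> P (k + 1)) -> (forall k, P k -> P (k - 1)) ->
  forall k, P k.
Proof.
move=> P0 PS PN; elim=> [//|n /PS|n /PN]; first by rewrite -PoszD addn1.
by rewrite -opprD -PoszD addn1.
Qed.

Lemma K0_intD m n : K0_eq (K0_int (m + n)) (K0_add (K0_int m) (K0_int n)).
Proof.
elim/int_step_ind: m => [|m IHm|m IHm].
- by rewrite add0r /=; ring.
- have -> : m + 1 + n = (m + n) + 1 by rewrite addrAC.
  by rewrite !K0_int_succ IHm; ring.
- have -> : m - 1 + n = (m + n) - 1 by rewrite addrAC.
  by rewrite !K0_int_pred IHm; ring.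
Qed.

Lemma K0_intM m n : K0_eq (K0_int (m * n)) (K0_mul (K0_int m) (K0_int n)).
Proof.
elim/int_step_ind: m => [|m IHm|m IHm].
- by rewrite mul0r /=; ring.
- by rewrite mulrDl mul1r K0_int_succ (K0_intD (m * n)) IHm; ring.
- have := K0_intD ((m - 1) * n) n; rewrite {1}mulrBl mul1r subrK IHm => e.
  have -> : K0_eq (K0_int ((m - 1) * n))
      (K0_sub (K0_mul (K0_int m) (K0_int n)) (K0_int n)) by rewrite e; ring.
  by rewrite K0_int_pred; ring.
Qed.

(** [K0_poly] is a Horner scheme on the list of coefficients. The list of P X +
    c drops trailing zeros, which affects the case P = 0 only. *)
Lemma K0_poly_cons (P : {poly int}) c :
  K0_eq (K0_poly (P * 'X + c%:P)) (K0_add (K0_int c) (K0_mul K0_L (K0_poly P))).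
Proof.
rewrite -cons_poly_def /K0_poly polyseq_cons.
case: ifP => [_|/negbFE]; first by reflexivity.
rewrite nil_poly => /eqP->; rewrite polyseqC polyseq0.
have [->|_] := eqVneq c 0; rewrite /=; ring.
Qed.

Lemma poly_consP (P : {poly int}) : exists Q c, P = Q * 'X + c%:P.
Proof.
elim/poly_ind: P => [|P c _]; last by exists P, c.
by exists 0, 0; rewrite mul0r addr0.
Qed.

Lemma K0_polyD P Q : K0_eq (K0_poly (P + Q)) (K0_add (K0_poly P) (K0_poly Q)).
Proof.
elim/poly_ind: P Q => [|P c IHP] Q.
  by rewrite add0r /K0_poly polyseq0 /=; ring.
have [Q' [d ->]] := poly_consP Q.
rewrite addrACA -mulrDl -polyCD !K0_poly_cons IHP K0_intD; ring.
Qed.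

Lemma K0_polyZ c P : K0_eq (K0_poly (c *: P)) (K0_mul (K0_int c) (K0_poly P)).
Proof.
elim/poly_ind: P => [|P d IHP].
  by rewrite scaler0 /K0_poly polyseq0 /=; ring.
rewrite scalerDr scalerAl -[c *: d%:P]mul_polyC -polyCM !K0_poly_cons IHP K0_intM.
ring.
Qed.

Lemma K0_polyM P Q : K0_eq (K0_poly (P * Q)) (K0_mul (K0_poly P) (K0_poly Q)).
Proof.
elim/poly_ind: P => [|P c IHP].
  by rewrite mul0r /K0_poly polyseq0 /=; ring.
rewrite mulrDl mul_polyC K0_polyD K0_polyZ K0_poly_cons mulrAC.
rewrite -[P * Q * 'X]addr0 K0_poly_cons IHP /=; ring.
Qed.

Lemma K0_poly1 : K0_eq (K0_poly 1) K0_one.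
Proof. by rewrite /K0_poly polyseq1 /=; ring. Qed.

Lemma K0_polyX : K0_eq (K0_poly 'X) K0_L.
Proof. by rewrite /K0_poly polyseqX /=; ring. Qed.

Lemma K0_motivic : motivic has_class.
Proof.
split.
- move=> X Y P XY [hX e]; exists (variety_iso XY hX); rewrite -e.
  exact/K0_iso/isomorphic_sym.
- exists (affine_variety 0); rewrite K0_poly1; exact/K0_point/isomorphic_refl.
- by exists affine1_variety; rewrite K0_polyX; reflexivity.
- move=> X Y P Q [hX eX] [hY eY]; exists (variety_prod hX hY).
  rewrite K0_polyM -eX -eY; exact/K0_product/isomorphic_refl.
- move=> X Z U i P Q hX icl iU [hZ eZ] [hU eU]; exists hX.
  by rewrite K0_polyD -eZ -eU; exact: K0_scissors iU.
- move=> X Z U i P Q hU icl iU [hX eX] [hZ eZ]; exists hU.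
  have := K0_scissors hX hZ hU icl iU; rewrite eX => e.
  rewrite -scaleN1r K0_polyD K0_polyZ e -eZ /=; ring.
Qed.

(** * Torifications *)

(** The pieces are indexed by a finite type, and bijectivity on points is spelt
    out as covering and disjointness. *)
Definition partition_fin (X : zfunctor) (J : finType) (Z : J -> zfunctor)
    (f : forall j, zmor (Z j) X) :=
  [/\ forall j, immersion (f j),
      forall (K : fieldType) (x : X K), exists j, image_of (f j) x
    & forall (K : fieldType) (x : X K) j j',
        image_of (f j) x -> image_of (f j') x -> j = j'].

Lemma partition_fin_by (X : zfunctor) (n : nat) (Z : 'I_n -> zfunctor)
    (f : forall i, zmor (Z i) X) :
  partition_fin f -> partitioned_by f.
Proof.
move=> [imm cov disj]; split=> // K; apply: bij_inj_surj.
  move=> [i z] [i' z'] /= e; have ii' : i = i'.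
    by apply: (disj K (f i K z)); [exists z | exists z'].
  by subst i'; congr existT; have [inj _] := imm i; exact: inj.
by move=> x; have [i [z zx]] := cov K x; exists (existT _ i z).
Qed.

(** The exponents are read off a list, so the type of the j-th torus mentions
    an entry of that list and [f] has to be transported to it. Only the images
    of the transported maps matter. *)
Lemma torification_fin (X : zfunctor) (J : finType) (k : J -> nat)
    (f : forall j, zmor (torus (k j)) X) :
  partition_fin f -> geometric_torification X [seq k j | j <- enum J].
Proof.
move=> [imm cov disj]; set s := [seq _ | _ <- _].
have sJ : size s = #|J| by rewrite size_map cardE.
pose j (i : 'I_(size s)) := enum_val (cast_ord sJ i).
have kj (i : 'I_(size s)) : nth 0%N s i = k (j i).
  have lt : (i < size (enum J))%N by rewrite -cardE -sJ.
  by rewrite (nth_map (j i)) //; congr k; exact: set_nth_default.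
have ex (i : 'I_(size s)) : exists g : zmor (torus (nth 0%N s i)) X,
    immersion g /\
    forall (K : fieldType) (x : X K), image_of g x <-> image_of (f (j i)) x.
  by rewrite kj; exists (f (j i)).
pose e i := sval (cid (ex i)); have eP i := svalP (cid (ex i)).
exists e; apply: partition_fin_by; split=> [i|K x|K x i i'].
- by have [] := eP i.
- have [a ax] := cov K x; exists (cast_ord (esym sJ) (enum_rank a)).
  by apply/(eP _).2; rewrite /j cast_ordKV enum_rankK.
- move=> /(eP i).2 ix /(eP i').2 ix'.
  by have /enum_val_inj/cast_ord_inj := disj K x _ _ ix ix'.
Qed.

Section Stratum.
Variables (n : nat) (A : {set 'I_n}).

(** The locus of A^n where the coordinates in [A] are invertible and the others
    vanish. The sum has a single term if [i] is in [A], and none otherwise. *)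
Definition stratum : zmor (torus #|A|) (affine n).
Proof.
exists (fun (R : comPzRingType) (x : torus #|A| R) =>
  \row_i \sum_(j < #|A| | enum_val j == i) sval (x j : unit_pts R)).
by move=> R S f x; apply/rowP => i; rewrite !mxE rmorph_sum.
Defined.

Lemma stratum_in (R : comPzRingType) (x : torus #|A| R) j :
  (stratum R x : 'rV[R]_n) 0 (enum_val j) = sval (x j : unit_pts R).
Proof.
by rewrite mxE (big_pred1 j) // => i; rewrite (inj_eq enum_val_inj).
Qed.

Lemma stratum_out (R : comPzRingType) (x : torus #|A| R) i :
  i \notin A -> (stratum R x : 'rV[R]_n) 0 i = 0.
Proof.
move=> iA; rewrite mxE big_pred0 // => j; apply: contraNF iA => /eqP <-.
exact: enum_valP.
Qed.

Definition stratum_open (R : comPzRingType) (v : affine n R) :=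
  forall i, i \in A -> exists w, (v : 'rV[R]_n) 0 i * w = 1.

Lemma stratum_image (R : comPzRingType) (v : affine n R) :
  image_of stratum v <->
  stratum_open v /\ (forall i, i \notin A -> (v : 'rV[R]_n) 0 i = 0).
Proof.
split=> [[x <-]|[vU v0]].
  split=> [i iA|i]; last exact: stratum_out.
  rewrite -(enum_rankK_in iA iA) stratum_in; exact: (svalP (x _ : unit_pts R)).
exists (fun j => exist (fun u => exists w, u * w = 1) _ (vU _ (enum_valP j))).
apply/rowP => i.
have [iA|iA] := boolP (i \in A); last by rewrite stratum_out ?v0.
by rewrite -(enum_rankK_in iA iA) stratum_in.
Qed.

(** A product is invertible exactly if all factors are; hence the locus where
    several functions are invertible is the open set of one function. *)
Lemma unit_prodP (R : comPzRingType) (I : finType) (P : pred I) (F : I -> R) :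
  (exists w, (\prod_(i | P i) F i) * w = 1) <->
  (forall i, P i -> exists w, F i * w = 1).
Proof.
split=> [[w e] i Pi|Fu].
  by exists ((\prod_(j | P j && (j != i)) F j) * w); rewrite mulrA -bigD1.
elim/big_ind: _ => //; first by exists 1; rewrite mulr1.
by move=> x y [u xu] [v yv]; exists (u * v); rewrite mulrACA xu yv mulr1.
Qed.

Lemma stratum_open_sub : open_sub stratum_open.
Proof.
move=> R v; exists (eq (\prod_(i in A) (v : 'rV[R]_n) 0 i)) => S f.
rewrite -[generates_unit_ideal _]/(ideal_span _ 1).
have -> : (fun s => exists2 r, \prod_(i in A) v 0 i = r & s = f r) =
    eq (\prod_(i in A) f (v 0 i)).
  apply: funext => s; apply: propext; rewrite -rmorph_prod.
  by split=> [[_ <- ->]|<-] //; exists (\prod_(i in A) v 0 i).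
rewrite ideal_span1P unit_prodP.
by split=> h i /h[w]; [rewrite mxE|]; exists w; rewrite ?mxE.
Qed.

Lemma stratum_immersion : immersion stratum.
Proof.
split=> [R x y e|].
  apply: functional_extensionality_dep => j; apply: sval_inj.
  by rewrite -!stratum_in e.
exists stratum_open; split=> [|R v /stratum_image[]//|R v vU].
  exact: stratum_open_sub.
exists (fun r => exists2 i, i \notin A & r = (v : 'rV[R]_n) 0 i) => S f.
rewrite stratum_image; split=> [[_ h] _ [i iA ->]|h].
  by have := h i iA; rewrite mxE.
split=> i iA; last by rewrite mxE h //; exists i.
by have [w vw] := vU i iA; exists (f w); rewrite mxE -rmorphM vw rmorph1.
Qed.

Lemma stratum_field (K : fieldType) (v : affine n K) :
  image_of stratum v <-> A = [set i | (v : 'rV[K]_n) 0 i != 0].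
Proof.
rewrite stratum_image; split=> [[vU v0]|AE].
  apply/setP => i; rewrite inE; have [iA|iA] := boolP (i \in A).
    have [w vw] := vU i iA; apply/esym/eqP => vi.
    by move/eqP: vw; rewrite vi mul0r eq_sym oner_eq0.
  by rewrite v0 // eqxx.
split=> i; rewrite AE inE; last by move=> /negPn/eqP.
by move=> vi; exists (v 0 i)^-1; rewrite mulfV.
Qed.

End Stratum.

Lemma affine_partition n : partition_fin (@stratum n).
Proof.
split=> [A|K v|K v A B /stratum_field -> /stratum_field -> //].
  exact: stratum_immersion.
by eexists; apply/stratum_field.
Qed.

(** Expand the n-th power of (X - 1) + 1. *)
Lemma sum_strata n :
  \sum_(A : {set 'I_n}) ('X - 1) ^+ #|A| = 'X ^+ n :> {poly int}.
Proof.
rewrite -[in RHS](subrK 1 'X) -[n in RHS]card_ord -prodr_const.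
rewrite (bigA_distr _ _ (fun=> 'X - 1) (fun=> 1)).
by apply: eq_big => [A|A _]; rewrite ?inE // -big_mkcond prodr_const.
Qed.

Definition union_strata_dim (A : {set 'I_0} + {set 'I_1}) : nat :=
  match A with inl B => #|B| | inr B => #|B| end.

Definition union_strata (A : {set 'I_0} + {set 'I_1}) :
    zmor (torus (union_strata_dim A)) (zunion (affine 0) (affine 1)) :=
  match A with
  | inl B => zcomp (zinl (affine 0) (affine 1)) (stratum B)
  | inr B => zcomp (zinr (affine 0) (affine 1)) (stratum B)
  end.

Lemma union_partition : partition_fin union_strata.
Proof.
have [sh0 _ _] := affine_variety 0; have [sh1 _ _] := affine_variety 1.
split=> [[B|B]|K p|K p].
- exact: (immersion_summand (zinl_summand _ sh0) (stratum_immersion B)).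
- exact: (immersion_summand (zinr_summand _ sh1) (stratum_immersion B)).
- have [[v <-]|[v <-]] := union_field p sh0 sh1.
    have [_ /(_ K v)[B [x <-]] _] := affine_partition 0.
    by exists (inl B), x.
  have [_ /(_ K v)[B [x <-]] _] := affine_partition 1.
  by exists (inr B), x.
have no (x : affine 0 K) (y : affine 1 K) : zinl _ _ K x <> zinr _ _ K y.
  by move=> /zinl_zinr/eqP; rewrite oner_eq0.
case=> B; case=> C [x <-] [y] //=.
- move=> /(zinl_inj sh0) yx; congr inl; have [_ _ disj] := affine_partition 0.
  by apply: (disj K (stratum B K x)); [exists x | exists y].
- by move=> e; case: (no (stratum B K x) (stratum C K y)).
- by move=> e; case: (no (stratum C K y) (stratum B K x)).
- move=> /(zinr_inj sh1) yx; congr inr; have [_ _ disj] := affine_partition 1.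
  by apply: (disj K (stratum B K x)); [exists x | exists y].
Qed.

(** The summand 1 of N_sigma and its term X with m = 0 are both multiples of
    the empty q-factorial, so they add up to alpha_0 = 1 + X. Hence A^0 and A^1
    are united in the piece of index 0. *)
Definition sigma_piece (m : nat) : zfunctor :=
  if m is 0 then zunion (affine 0) (affine 1) else affine m.+1.

Definition sigma_tori (m : nat) : seq nat :=
  if m is 0 then [seq union_strata_dim A | A : {set 'I_0} + {set 'I_1}]
  else [seq #|A| | A : {set 'I_m.+1}].

Definition sigma_alpha (m : nat) : {poly int} :=
  if m is 0 then 1 + 'X else 'X ^+ m.+1.

Lemma sigma_alphaE m : \sum_(j <- sigma_tori m) ('X - 1) ^+ j = sigma_alpha m.
Proof.
case: m => [|m] /=; rewrite big_map big_enum /=; last exact: sum_strata.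
by rewrite big_sumType /= !sum_strata.
Qed.

Lemma sigma_piece_variety m : is_variety (sigma_piece m).
Proof.
case: m => [|m]; last exact: affine_variety.
by apply: variety_union; exact: affine_variety.
Qed.

Lemma sigma_piece_torification m :
  geometric_torification (sigma_piece m) (sigma_tori m).
Proof.
case: m => [|m]; first exact: torification_fin union_partition.
exact: torification_fin (affine_partition m.+2).
Qed.

Lemma motivic_sigma_piece M m : motivic M -> M (sigma_piece m) (sigma_alpha m).
Proof.
move=> MP; case: m => [|m]; last exact: motivic_affine.
apply: motivic_union => //; try exact: affine_variety.
  exact: motivic_point.
exact: motivic_line.
Qed.

Lemma isomorphic_prod_flag0 X : isomorphic (zprod X (punctured_flag 0)) X.
Proof.
have F_nat (R S : comPzRingType) (f : {rmorphism R -> S})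
  (p : zprod X (punctured_flag 0) R) : (act f p).1 = act f p.1 by [].
apply: (@isomorphic_bij _ _ (ZMor F_nat)) => R.
  move=> [x u] [y v] /= ->; congr pair.
  by apply: functional_extensionality_dep => -[].
move=> x; have u : punctured_flag 0 R by case.
by exists (x, u).
Qed.

(** Both stages consist of the same summands: the first two of them are grouped
    into the piece of index 0, times a point. *)
Lemma isomorphic_sigma N : isomorphic (X_sigma N.+1)
  (union_upto zempty (fun m => zprod (sigma_piece m) (punctured_flag m)) N.+1).
Proof.
elim: N => [|N IHN]; last first.
  by apply: isomorphic_union => //; exact: isomorphic_refl.
apply: isomorphic_trans (isomorphic_union (isomorphic_refl _)
  (isomorphic_prod_flag0 _)) _.
apply: isomorphic_trans (isomorphic_sym (isomorphic_prod_flag0 _)) _.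
apply: isomorphic_empty_union.
have [] // := variety_prod (sigma_piece_variety 0) (flag_variety 0).
Qed.

Lemma isomorphism_immersion (X Y : zfunctor) (f : zmor X Y) :
  (forall R, injective (f R)) -> (forall R y, @image_of _ _ f R y) -> immersion f.
Proof.
move=> finj fsurj; split=> //; exists (@zfull Y); split=> //.
  move=> R y; exists (eq 1) => S h; split=> // _.
  by apply: ideal_span_gen; exists 1; rewrite ?rmorph1.
by move=> R y _; exists (fun=> False) => S h; split.
Qed.

Lemma piecewise_iso (X Y : zfunctor) :
  is_variety X -> isomorphic X Y -> piecewise_isomorphic X Y.
Proof.
move=> Xv /isomorphicP[f [finj fsurj]].
have single (W : zfunctor) (g : zmor X W) : (forall R, injective (g R)) ->
    (forall R w, @image_of _ _ g R w) -> @partitioned_by W 1 (fun=> X) (fun=> g).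
  move=> ginj gsurj; apply: partition_fin_by; split.
  - by move=> _; exact: isomorphism_immersion.
  - by move=> K w; exists ord0.
  - by move=> K w i j _ _; rewrite !ord1.
exists 1%N, (fun=> X), (fun=> zid X), (fun=> f); split=> //;
  apply: single => // R x; last by exists x.
by move=> y.
Qed.

(** * The Habiro ring *)

Lemma qfactS n : qfact n.+1 = qfact n * ('X ^+ n.+1 - 1).
Proof. by rewrite /qfact big_ord_recr. Qed.

Lemma qfact_monic n : qfact n \is monic.
Proof.
by rewrite /qfact; apply: monic_prod => i _; rewrite -polyC1 monicXnsubC.
Qed.

Lemma size_qfact n : (1 < size (qfact n.+1))%N.
Proof.
have Xn0 : 'X ^+ n.+1 - 1 != 0 :> {poly int}.
  by rewrite -polyC1 monic_neq0 // monicXnsubC.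
rewrite qfactS size_monicM ?qfact_monic // -polyC1 size_XnsubC // addnS /=.
by rewrite -addn1 leq_add // size_poly_gt0 monic_neq0 ?qfact_monic.
Qed.

Lemma mk_monic_qfact n : mk_monic (qfact n.+1) = qfact n.+1.
Proof. by rewrite /mk_monic size_qfact qfact_monic. Qed.

Lemma in_qpoly_mod n P Q :
  in_qpoly (qfact n.+1) (P + Q * qfact n.+1) = in_qpoly (qfact n.+1) P.
Proof.
rewrite in_qpolyD -[RHS]addr0; congr (_ + _); apply: val_inj => /=.
by rewrite mk_monic_qfact Pdiv.RingMonic.rmodp_mull ?qfact_monic.
Qed.

(** The residue modulo a multiple of a polynomial determines the residue modulo
    this polynomial. *)
Lemma in_qpoly_lift n P :
  in_qpoly (qfact n.+1) (in_qpoly (qfact n.+2) P : {poly int}) =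
  in_qpoly (qfact n.+1) P.
Proof.
rewrite /= mk_monic_qfact.
rewrite [in RHS](Pdiv.RingMonic.rdivp_eq (qfact_monic n.+2) P) addrC.
by rewrite [X in _ * X]qfactS [qfact n.+1 * _]mulrC mulrA in_qpoly_mod.
Qed.

(** All further terms are divisible by [qfact n.+1]. *)
Lemma N_sigma_mod n d :
  in_qpoly (qfact n.+1) (N_sigma (n.+1 + d)) =
  in_qpoly (qfact n.+1) (N_sigma n.+1).
Proof.
elim: d => [|d IHd]; first by rewrite addn0.
rewrite addnS N_sigmaS -IHd.
have [Q ->] : exists Q, qfact (n.+1 + d) = Q * qfact n.+1; last first.
  by rewrite mulrA in_qpoly_mod.
elim: d {IHd} => [|d [Q QE]]; first by exists 1; rewrite addn0 mul1r.
by exists (('X ^+ (n.+1 + d).+1 - 1) * Q); rewrite addnS qfactS QE mulrC mulrA.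
Qed.

Lemma sigma_habiro_coherent n :
  in_qpoly (qfact n.+1) (N_sigma n.+1) =
  in_qpoly (qfact n.+1) (in_qpoly (qfact n.+2) (N_sigma n.+2) : {poly int}).
Proof. by rewrite in_qpoly_lift -[n.+2]addn1 N_sigma_mod. Qed.

Definition sigma_habiro : habiro := Habiro sigma_habiro_coherent.

Lemma sigma_partial_sum N : habiro_partial_sum sigma_alpha N.+1 = N_sigma N.+1.
Proof.
rewrite /habiro_partial_sum; elim: N => [|N IHN].
  by rewrite big_ord1 N_sigmaS /N_sigma /qfact !big_ord0 addr0 !mulr1.
by rewrite big_ord_recr /= IHN [RHS]N_sigmaS.
Qed.

Lemma sigma_habiro_series : habiro_series sigma_alpha sigma_habiro.
Proof.
move=> n [//|M] nM; rewrite sigma_partial_sum /=.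
by rewrite -(subnKC nM) addSn -addSn N_sigma_mod.
Qed.

(** * The ind-variety *)

Lemma sigma_F1_structure : F1_structure X_sigma.
Proof.
split.
  move=> N _; split; first exact: X_sigma_variety.
  apply: closed_immersion_summand; apply: zinl_summand.
  by have [] := X_sigma_variety N.
exists sigma_piece, sigma_tori; cbv zeta.
have alphaE : (fun m => \sum_(j <- sigma_tori m) ('X - 1) ^+ j) = sigma_alpha.
  by apply: funext => m; exact: sigma_alphaE.
rewrite alphaE; split=> [m|[//|N] _||].
- by split; [exact: sigma_piece_variety | exact: sigma_piece_torification].
- exact: piecewise_iso (X_sigma_variety N.+1) (isomorphic_sigma N).
- split=> [m|].
    by rewrite sigma_alphaE; exact: motivic_sigma_piece K0_motivic.
  exists N_sigma; split=> [N _|]; first exact: motivic_sigma K0_motivic.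
  by exists sigma_habiro; split; [move=> n | exact: sigma_habiro_series].
- split=> [m|].
    by rewrite sigma_alphaE; exact: motivic_sigma_piece counting_motivic.
  exists N_sigma; split=> [N _|]; first exact: motivic_sigma counting_motivic.
  by exists sigma_habiro; split; [move=> n | exact: sigma_habiro_series].
Qed.

(** * Positivity *)

Section Positivity.
Variable q : int.
Hypothesis q_le : q <= -2.

(** The m-th term of N_sigma at q. *)
Definition sigma_term (m : nat) : int := q ^+ m.+1 * (qfact m).[q].
Local Notation t := sigma_term.

Lemma N_sigma_evalS m : (N_sigma m.+1).[q] = (N_sigma m).[q] + t m.
Proof. by rewrite N_sigmaS hornerD hornerM hornerXn. Qed.

Lemma termS m : t m.+1 = t m * (q * (q ^+ m.+1 - 1)).
Proof.
rewrite /sigma_term qfactS hornerM hornerD hornerN hornerXn hornerC (exprS q m.+1).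
by rewrite [q * q ^+ _]mulrC mulrACA.
Qed.

Lemma q_neg : q < 0.
Proof. exact: (le_lt_trans q_le). Qed.

Lemma normq_ge2 : 2 <= `|q|.
Proof. rewrite (ltr0_norm q_neg) lerNr; exact: q_le. Qed.

(** The quotient of consecutive terms is q (q^(m+1) - 1). Its two factors have
    absolute values at least 2 and at least |q|^(m+1) - 1 >= 1. *)
Lemma term_norm m : 2 * `|t m| <= `|t m.+1|.
Proof.
rewrite termS [leRHS]normrM [leLHS]mulrC; apply: ler_wpM2l.
  exact: normr_ge0.
rewrite normrM -[X in X <= _]mulr1; apply: ler_pM; rewrite ?normq_ge2 //.
have := lerB_dist (q ^+ m.+1) 1; rewrite normr1 normrX.
apply: le_trans; rewrite lerBrDr.
apply: le_trans normq_ge2 _; rewrite -[X in X <= _]expr1.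
by apply: ler_weXn2l => //; exact: le_trans normq_ge2.
Qed.

(** As the terms at least double in absolute value, each of them dominates the
    sum of 1 and all the earlier ones. *)
Lemma N_sigma_le_term m : `|(N_sigma m).[q]| <= `|t m|.
Proof.
elim: m => [|m IHm].
  rewrite /sigma_term /N_sigma /qfact !big_ord0 addr0 !hornerC expr1 mulr1 normr1.
  exact: le_trans normq_ge2.
rewrite N_sigma_evalS; apply: le_trans (term_norm m).
by rewrite (le_trans (ler_normD _ _)) // mulr_natl mulr2n lerD2r.
Qed.

Lemma N_sigma_ge0 m : 0 <= t m -> 0 <= (N_sigma m.+1).[q].
Proof.
move=> t0; rewrite N_sigma_evalS -lerBlDr sub0r.
by have := N_sigma_le_term m; rewrite (ger0_norm t0) ler_norml => /andP[].
Qed.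

(** Both factors are negative, as an odd power of q is. *)
Lemma factor_ge0 m : ~~ odd m -> 0 <= q * (q ^+ m.+1 - 1).
Proof.
move=> m_even; rewrite (nmulr_rge0 _ q_neg) subr_le0.
apply: (@le_trans _ _ 0) => //; rewrite exprn_odd_le0 //=; exact: ltW q_neg.
Qed.

(** Here q is negative, and its even power is at least 1. *)
Lemma factor_le0 m : odd m -> q * (q ^+ m.+1 - 1) <= 0.
Proof.
move=> m_odd; rewrite (nmulr_rle0 _ q_neg) subr_ge0.
rewrite -[q]opprK exprNn -signr_odd /= m_odd mul1r; apply: exprn_ege1.
by rewrite lerNr; exact: le_trans q_le _.
Qed.

(** By [factor_ge0] and [factor_le0] the quotients of consecutive terms are
    alternately nonnegative and nonpositive, so signs have period four. *)
Lemma term_sign_step m : ~~ odd m -> t m <= 0 ->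
  [/\ 0 <= t m.+2, 0 <= t m.+3 & t m.+4 <= 0].
Proof.
move=> m_even t0.
have t1 : t m.+1 <= 0 by rewrite termS mulr_le0_ge0 // factor_ge0.
have t2 : 0 <= t m.+2 by rewrite termS mulr_le0 // factor_le0.
have t3 : 0 <= t m.+3 by rewrite termS mulr_ge0 // factor_ge0 //= negbK.
by split=> //; rewrite termS mulr_ge0_le0 // factor_le0 //= negbK.
Qed.

Lemma term_sign k : [/\ t (4 * k) <= 0, 0 <= t (4 * k).+2 & 0 <= t (4 * k).+3].
Proof.
suff t0 : t (4 * k) <= 0.
  by have [] := @term_sign_step (4 * k) _ t0; rewrite ?oddM.
elim: k => [|k t0].
  rewrite muln0 /sigma_term expr1 /qfact big_ord0 hornerC mulr1; exact: ltW q_neg.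
have [|_ _ t4] := @term_sign_step (4 * k) _ t0; first by rewrite oddM.
by rewrite mulnS addnC addn4.
Qed.

End Positivity.

(** The last term has index n - 1, which is 2 or 3 modulo 4, so it is
    nonnegative by [term_sign] and dominates the others. For n = 1 the point of
    evaluation is 0, and the value is 1. *)
Lemma N_sigma_nonneg n :
  [\/ n = 1%N, exists k : nat, n = (4 * k + 3)%N
    | exists k : nat, (0 < k)%N /\ n = (4 * k)%N] ->
  0 <= (N_sigma n).[1 - n%:Z].
Proof.
have q_le m : (2 < m)%N -> 1 - m%:Z <= -2.
  by move=> m3; rewrite lerBlDr -lerBlDl opprK lez_nat.
case=> [->|[k ->]|[[|k] [k_gt0 ->]]] //.
- rewrite N_sigmaS /N_sigma /qfact !big_ord0 addr0 mulr1 expr1 hornerD hornerX.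
  by rewrite hornerC.
- rewrite addn3; have q2 : 1 - ((4 * k).+3)%:Z <= -2 by exact: q_le.
  by apply: N_sigma_ge0 => //; have [] := term_sign q2 k.
have -> : (4 * k.+1)%N = (4 * k).+4 by rewrite mulnS addnC addn4.
have q2 : 1 - ((4 * k).+4)%:Z <= -2 by exact: q_le.
by apply: N_sigma_ge0 => //; have [] := term_sign q2 k.
Qed.

Theorem proposition7p5 :
  [/\ forall n : nat, (0 < n)%N -> counting_polynomial (X_sigma n) (N_sigma n),
      forall n : nat,
        [\/ n = 1%N, exists k : nat, n = (4 * k + 3)%N
          | exists k : nat, (0 < k)%N /\ n = (4 * k)%N] ->
        0 <= (N_sigma n).[1 - n%:Z]
    & forall (n : nat) (zeta : algC), n.-primitive_root zeta ->
        (exists k : nat, n = (4 * k + 3)%N) \/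
          (exists k : nat, (0 < k)%N /\ n = (4 * k)%N) ->
        Fzeta_structure X_sigma zeta].
Proof.
split=> [n _|n|n zeta zetaP nE].
- exact: motivic_sigma counting_motivic.
- exact: N_sigma_nonneg.
- split; first exact: sigma_F1_structure.
  exists n; split=> //; exists (N_sigma n); split.
    exact: motivic_sigma counting_motivic.
  by apply: N_sigma_nonneg; case: nE => nE; [constructor 2 | constructor 3].
Qed.
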